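(* Let $f:\mathbb{R}^n\to\mathbb{R}$ be $\mathcal{C}^2$ in a neighborhood of a nondegenerate critical point $\bar x$ of Morse index one, let $H=\nabla^2f(\bar x)$, and let $\bar v$ be a unit eigenvector corresponding to the negative eigenvalue of $H$. Then there is $\alpha_0>0$ such that for every unit vector $v$ with $\|v-\bar v\|<\alpha_0$ the following holds. For every $\epsilon>0$ there are $\delta>0$, $\gamma>0$ and convex neighborhoods $U_\delta\subset U_\delta'$ of $\bar x$ satisfying condition $P(f,\delta,\gamma,U_\delta,U_\delta')$ such that for all $l\in(f(\bar x)-\gamma,f(\bar x)]$: (a) $g_{l,v}^2:U_\delta\to\mathbb{R}$ is convex on $U_\delta$; (b) $\|\nabla^2(g_{l,v}^2)(x)-\nabla^2(\bar g_{l,v}^2)(x)\|\le\epsilon$ for all $x\in U_\delta$ satisfying $g_{l,v}(x)>0$, where $$\nabla^2(\bar g_{l,v}^2)(x)=\frac{8}{(v^THv)^2}\big[Hvv^TH-(v^THv)H\big].$$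
   Context: A critical point $\bar x$ is nondegenerate of Morse index one if $\nabla^2 f(\bar x)$ is invertible with exactly one negative eigenvalue (hence $n-1$ positive ones). Parallel distance: with $U_\delta\subset U_\delta'$ the given convex neighborhoods of $\bar x$, $l\in\mathbb{R}$ and a unit vector $v$, set $S_{l,v}(x):=U_\delta'\cap\{x+tv:t\in\mathbb{R},\ f(x+tv)\ge l\}$, and for $x\in U_\delta$ let $g_{l,v}(x):=\operatorname{diam}(S_{l,v}(x))$, with $g_{l,v}(x)=0$ if $S_{l,v}(x)=\emptyset$. Here $g_{l,v}^2$ denotes $x\mapsto g_{l,v}(x)^2$. $\bar g_{l,v}$ is the parallel distance defined in the same way (with all neighborhoods equal to $\mathbb{R}^n$) from the quadratic $\bar f(x)=\frac12(x-\bar x)^TH(x-\bar x)+f(\bar x)$ in place of $f$. Condition $P(f,\delta,\gamma,U_\delta,U_\delta')$ (for the given $v$): (1) $\|\nabla^2f(x)-\nabla^2f(\bar x)\|\le\delta$ for all $x\in U_\delta'$; (2) with $\bar f_\delta(x)=\frac12(x-\bar x)^T[H+\delta I](x-\bar x)+f(\bar x)$ and $\bar S_{\delta,l,v}(x)=\{x+tv:t\in\mathbb{R},\ \bar f_\delta(x+tv)\ge l\}$, one has $\bar S_{\delta,l,v}(x)\subset U_\delta'$ for all $x\in U_\delta$ and all $l\in(f(\bar x)-\gamma,f(\bar x)]$. *)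

(* Defs.v *)
From HB Require Import structures.
From mathcomp Require Export all_boot all_order all_algebra.
From mathcomp Require Export all_classical all_reals all_analysis.

Set Implicit Arguments.
Unset Strict Implicit.
Unset Printing Implicit Defensive.

Import Order.TTheory GRing.Theory Num.Theory.
Import numFieldNormedType.Exports.

Local Open Scope classical_set_scope.
Local Open Scope ring_scope.

(* Points of R^n are column vectors. The topology of 'cV[R]_n is that of the
   max norm `|x|, so nbhs, open, differentiable and bounded_set have their usual
   meaning; lengths are measured by the Euclidean norm below. *)

Definition enorm (R : realType) (n : nat) (u : 'cV[R]_n) : R :=
  Num.sqrt (\sum_i u i 0 ^+ 2).

(* The operator (spectral) norm induced by enorm. *)
Definition opnorm (R : realType) (n : nat) (A : 'M[R]_n) : R :=
  sup [set enorm (A *m u) | u in [set u : 'cV[R]_n | enorm u <= 1]].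

(* Since sup set0 = 0, the empty set has diameter 0. On an unbounded set sup
   is a junk value, so a claim about diam also needs bounded_set. *)
Definition diam (R : realType) (n : nat) (A : set 'cV[R]_n) : R :=
  sup [set enorm (p.1 - p.2) | p in A `*` A].

Definition gradient (R : realType) (n : nat) (f : 'cV[R]_n -> R)
    (x : 'cV[R]_n) : 'cV[R]_n :=
  \col_i 'D_(delta_mx i 0) f x.

Definition hessian (R : realType) (n : nat) (f : 'cV[R]_n -> R)
    (x : 'cV[R]_n) : 'M[R]_n :=
  \matrix_(i, j) 'D_(delta_mx j 0) (fun y => gradient f y i 0) x.

(* The derivatives in gradient and hessian are total, hence meaningful only
   under this hypothesis. *)
Definition twice_differentiable (R : realType) (n : nat) (f : 'cV[R]_n -> R)
    (x : 'cV[R]_n) : Prop :=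
  (\forall y \near x, differentiable f y) /\ differentiable (gradient f) x.

Definition C2_near (R : realType) (n : nat) (f : 'cV[R]_n -> R)
    (xbar : 'cV[R]_n) : Prop :=
  \forall x \near xbar,
    twice_differentiable f x /\ {for x, continuous (hessian f)}.

(* Eigenvalues are counted with multiplicity. Hessians of C^2 functions are
   symmetric, so the multiplicity of a is the dimension of its eigenspace, and
   the row eigenvectors of eigenspace are the transposed column ones. *)
Definition one_negative_eigenvalue (R : realType) (n : nat) (H : 'M[R]_n) :
    Prop :=
  exists a : R, [/\ a < 0, eigenvalue H a, \rank (eigenspace H a) = 1%N &
    forall b : R, b < 0 -> eigenvalue H b -> b = a].

Definition nondegenerate_critical_index1 (R : realType) (n : nat)
    (f : 'cV[R]_n -> R) (xbar : 'cV[R]_n) : Prop :=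
  [/\ gradient f xbar = 0, hessian f xbar \in unitmx &
    one_negative_eigenvalue (hessian f xbar)].

Definition quadratic_form (R : realType) (n : nat) (A : 'M[R]_n)
    (u : 'cV[R]_n) : R := (u^T *m A *m u) 0 0.

Definition quadratic_model (R : realType) (n : nat) (A : 'M[R]_n)
    (xbar : 'cV[R]_n) (c : R) (x : 'cV[R]_n) : R :=
  2^-1 * quadratic_form A (x - xbar) + c.

Definition line_superlevel (R : realType) (n : nat) (U' : set 'cV[R]_n)
    (f : 'cV[R]_n -> R) (l : R) (v x : 'cV[R]_n) : set 'cV[R]_n :=
  U' `&` [set x + t *: v | t in [set t : R | l <= f (x + t *: v)]].

Definition parallel_distance (R : realType) (n : nat) (U' : set 'cV[R]_n)
    (f : 'cV[R]_n -> R) (l : R) (v x : 'cV[R]_n) : R :=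
  diam (line_superlevel U' f l v x).

(* Neighborhoods are taken open, so that second derivatives at a point of U do
   not depend on values outside U. *)
Definition convex_open_nbhs (R : realType) (n : nat) (x : 'cV[R]_n)
    (U : set 'cV[R]_n) : Prop :=
  open_nbhs x U /\ convex_set U.

Definition condP (R : realType) (n : nat) (f : 'cV[R]_n -> R)
    (xbar v : 'cV[R]_n) (delta gamma : R) (U U' : set 'cV[R]_n) : Prop :=
  let H := hessian f xbar in
  (forall x, U' x -> twice_differentiable f x /\
                     opnorm (hessian f x - H) <= delta) /\
  (forall x l, U x -> f xbar - gamma < l <= f xbar ->
     line_superlevel setT (quadratic_model (H + delta%:M) xbar (f xbar)) l v x
       `<=` U').

(* Main.v *)
Require Import Defs.
From HB Require Import structures.
From mathcomp Require Import ring lra.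
Import Order.TTheory GRing.Theory Num.Theory.
Import numFieldNormedType.Exports.
Local Open Scope classical_set_scope.
Local Open Scope ring_scope.

Set Implicit Arguments.
Unset Strict Implicit.
Unset Printing Implicit Defensive.

(** Write H for the Hessian of f at xbar, a = - v^T H v > 0 and w = H v, and for a
    line x + t v let t1 < t2 be the two parameters where f takes the value l on
    it, so that the squared parallel distance is g^2 = (t2 - t1)^2.

    Existence of the chord. H has index one and is negative at v, hence positive
    definite, with a constant c > 0, on the H-orthogonal complement of v
    ([index1_coercive]; H is symmetric by Young's theorem [hessian_sym], and the
    spectral information is used through minimisers of the quadratic form on
    spheres of hyperplanes, [rayleigh_eigen]). So on every line the foot m of the H-orthogonal projection
    of xbar satisfies f(m) >= f(xbar) + (c/4) |m - xbar|^2 ([foot_value]), whereas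
    along v the function f is strongly concave: the set where f >= l is a segment
    whose endpoints depend continuously on the line ([sup_slice_continuous]).

    Derivatives. By the implicit function theorem the endpoints have gradients
    tau_i = - grad f(p_i) / D_i with D_i = grad f(p_i) . v, and Hessians
    - K_i^T D^2f(p_i) K_i / D_i with K_i = I + v tau_i^T
    ([endpoint_differentiable], [endpoint_twice_differentiable]). The D_i vanish
    with g, and the point is to bound the Hessian of g^2 uniformly. As the
    second derivative of f along v is close to - a, the height f(m) - l is at most
    a g^2, so that the foot lies at distance O(g) from xbar ([foot_dist]); the gradients of f at the endpoints are
    then O(g), the slopes D_i are +- a g / 2 up to a relative error O(e), where e
    bounds the oscillation of D^2f, the tau_i are bounded, and
    tau_1 + tau_2 = (2/a) w + O(e) ([chord_estimates]). Inserting this in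

      D^2(g^2) = 2 (tau_2 - tau_1)(tau_2 - tau_1)^T + 2 g (D^2 t2 - D^2 t1),

    the unknown tau_2 - tau_1 cancels and what remains is
    (8/a^2)(w w^T + a H) + O(e), the Hessian for the quadratic model
    ([square_hessian_close], [distance_hessian], [model_distance_hessian]).

    Convexity. The limit Hessian is positive definite only transversally to v, but
    g^2 is invariant under translations along v, so its Hessian may be tested on
    vectors H-orthogonal to v, where the limit is coercive
    ([distance_hessian_psd]). For l < f(xbar) the chord never degenerates and g^2
    is convex on the whole neighborhood ([dist_convex_below]); at l = f(xbar),
    where g may vanish, g^2 is the limit of its values at lower levels, strong
    concavity giving a modulus of continuity in l ([dist_level],
    [dist_convex]). *)

(** * Norms, inner product and differentiability in R^n *)

Section MaxNorm.
Variable R : realType.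

Lemma entry_le_norm m n (A : 'M[R]_(m, n)) i j : `|A i j| <= `|A|.
Proof. by rewrite [leRHS]/Num.norm/= mx_normrE; exact: (le_bigmax _ _ (i, j)). Qed.

Lemma norm_le_entries m n (A : 'M[R]_(m, n)) (e : R) :
  0 <= e -> (forall i j, `|A i j| <= e) -> `|A| <= e.
Proof.
move=> e0 Ae; rewrite [leLHS]/Num.norm/= mx_normrE.
by apply: bigmax_le => // -[i j] _; exact: Ae.
Qed.

Lemma norm_mulmx m n p (A : 'M[R]_(m, n)) (B : 'M[R]_(n, p)) :
  `|A *m B| <= n%:R * `|A| * `|B|.
Proof.
apply: norm_le_entries => [|i j]; first by rewrite !mulr_ge0.
rewrite mxE (le_trans (ler_norm_sum _ _ _))//.
rewrite -mulrA mulr_natl -[n in _ *+ n]card_ord -sumr_const.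
apply: ler_sum => k _; rewrite normrM.
by apply: ler_pM => //; exact: entry_le_norm.
Qed.

Lemma norm_trmx m n (A : 'M[R]_(m, n)) : `|A^T| = `|A|.
Proof.
apply/eqP; rewrite eq_le; apply/andP; split.
  by apply: norm_le_entries => // i j; rewrite mxE entry_le_norm.
by apply: norm_le_entries => // i j; rewrite -[A i j]/(A i j)
-{1}[A]trmxK mxE entry_le_norm.
Qed.

End MaxNorm.

Section Dot.
Variables (R : realType) (n : nat).
Implicit Types (u w z : 'cV[R]_n) (A B : 'M[R]_n).

(** The Euclidean inner product of R^n. *)
Definition dot u w : R := (u^T *m w) 0 0.

Lemma dotE u w : dot u w = \sum_i u i 0 * w i 0.
Proof. by rewrite /dot mxE; apply: eq_bigr => i _; rewrite mxE. Qed.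

Lemma dotC u w : dot u w = dot w u.
Proof. by rewrite !dotE; apply: eq_bigr => i _; rewrite mulrC. Qed.

Lemma dotDl u w z : dot (u + w) z = dot u z + dot w z.
Proof. by rewrite /dot linearD mulmxDl mxE. Qed.
Lemma dotDr u w z : dot z (u + w) = dot z u + dot z w.
Proof. by rewrite /dot mulmxDr mxE. Qed.
Lemma dotZl k u w : dot (k *: u) w = k * dot u w.
Proof. by rewrite /dot linearZ /= -scalemxAl mxE. Qed.
Lemma dotZr k u w : dot u (k *: w) = k * dot u w.
Proof. by rewrite dotC dotZl dotC. Qed.
Lemma dotNl u w : dot (- u) w = - dot u w.
Proof. by rewrite -scaleN1r dotZl mulN1r. Qed.
Lemma dotNr u w : dot u (- w) = - dot u w.
Proof. by rewrite dotC dotNl dotC. Qed.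
Lemma dotBl u w z : dot (u - w) z = dot u z - dot w z.
Proof. by rewrite dotDl dotNl. Qed.
Lemma dotBr u w z : dot z (u - w) = dot z u - dot z w.
Proof. by rewrite dotDr dotNr. Qed.
Lemma dot0l u : dot 0 u = 0.
Proof. by rewrite -(scale0r 0) dotZl mul0r. Qed.
Lemma dot0r u : dot u 0 = 0.
Proof. by rewrite dotC dot0l. Qed.

Lemma dot_mulmx A u w : dot (A *m u) w = dot u (A^T *m w).
Proof. by rewrite /dot trmx_mul mulmxA. Qed.

Lemma dot_sym A u w : A^T = A -> dot u (A *m w) = dot w (A *m u).
Proof. by move=> As; rewrite -{1}As -dot_mulmx dotC. Qed.

Lemma dot_delta u i : dot u (delta_mx i 0) = u i 0.
Proof.
rewrite dotE (bigD1 i)//= mxE !eqxx mulr1 big1 ?addr0// => j ji.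
by rewrite mxE (negbTE ji) mulr0.
Qed.

Lemma dot_delta_mulmx A i j :
  dot (delta_mx i 0) (A *m delta_mx j 0) = A i j.
Proof. by rewrite dotC dot_delta -colE mxE. Qed.

Lemma norm_dot u w : `|dot u w| <= n%:R * `|u| * `|w|.
Proof.
apply: le_trans (entry_le_norm _ _ _) _; rewrite -(norm_trmx u).
exact: norm_mulmx.
Qed.

Lemma norm_dot_mulmx A u w :
  `|dot u (A *m w)| <= n%:R ^+ 2 * `|A| * `|u| * `|w|.
Proof.
apply: le_trans (norm_dot _ _) _.
have -> : n%:R ^+ 2 * `|A| * `|u| * `|w| = n%:R * `|u| * (n%:R * `|A| * `|w|).
  by ring.
by apply: ler_wpM2l; [exact: mulr_ge0|exact: norm_mulmx].
Qed.

Lemma quadratic_formE A u : quadratic_form A u = dot u (A *m u).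
Proof. by rewrite /quadratic_form /dot mulmxA. Qed.

Lemma dot_ge0 u : 0 <= dot u u.
Proof. by rewrite dotE; apply: sumr_ge0 => i _; rewrite -expr2 sqr_ge0. Qed.

Lemma enormE u : enorm u = Num.sqrt (dot u u).
Proof. by rewrite /enorm dotE; under eq_bigr do rewrite expr2. Qed.

Lemma enorm_ge0 u : 0 <= enorm u.
Proof. by rewrite enormE sqrtr_ge0. Qed.

Lemma enorm_sqr u : enorm u ^+ 2 = dot u u.
Proof. by rewrite enormE sqr_sqrtr ?dot_ge0. Qed.

Lemma enormZ k u : enorm (k *: u) = `|k| * enorm u.
Proof. by rewrite !enormE dotZl dotZr mulrA -expr2 sqrtrM ?sqr_ge0// sqrtr_sqr. Qed.

Lemma norm_le_enorm u : `|u| <= enorm u.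
Proof.
apply: norm_le_entries => [|i j]; first exact: enorm_ge0.
rewrite -(@ler_pXn2r _ 2) ?nnegrE ?enorm_ge0// enorm_sqr real_normK ?num_real//.
rewrite ord1 dotE (bigD1 i)//= -expr2 lerDl.
by apply: sumr_ge0 => k _; rewrite -expr2 sqr_ge0.
Qed.

Lemma enorm_le_norm u : enorm u <= n%:R * `|u|.
Proof.
rewrite -(@ler_pXn2r _ 2) ?nnegrE ?enorm_ge0// ?mulr_ge0// enorm_sqr.
apply: le_trans (ler_norm _) _; apply: le_trans (norm_dot _ _) _.
rewrite exprMn expr2 -!mulrA; apply: ler_wpM2l => //.
rewrite -expr2.
have [n0|n0] := posnP n; last by rewrite ler_peMl ?sqr_ge0// ler1n.
have -> : u = 0 by apply/colP => i; have n1 := leq_ltn_trans (leq0n i) (ltn_ord i); rewrite n0 in n1.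
by rewrite normr0 expr0n mulr0.
Qed.

Lemma opnorm_le A (e : R) : `|A| <= e -> opnorm A <= n%:R ^+ 2 * e.
Proof.
move=> Ae; apply: ge_sup.
  exists (enorm (A *m 0)); exists 0 => //=.
  by rewrite enormE dot0l sqrtr0 ler01.
move=> _ [u /= u1 <-]; apply: le_trans (enorm_le_norm _) _.
rewrite expr2 -mulrA; apply: ler_wpM2l => //.
apply: le_trans (norm_mulmx _ _) _; rewrite -mulrA; apply: ler_wpM2l => //.
rewrite -[leRHS]mulr1; apply: ler_pM => //.
exact: le_trans (norm_le_enorm _) u1.
Qed.

End Dot.

Section Expansion.
Variables (R : realType) (V W : normedModType R).
Implicit Types (F : V -> W) (x : V).

Lemma differentiable_expand F x :
  differentiable F x -> forall e : R, 0 < e ->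
  \forall h \near (0 : V), `|F (x + h) - F x - 'd F x h| <= e * `|h|.
Proof.
move=> /diff_locally dF e e0; move/eqaddoP: dF => /(_ e e0).
apply: filterS => h; rewrite /= opprD addrA.
by rewrite -[X in `|X| <= _ -> _]/(F (h + x) - F x - 'd F x h) [h + x]addrC.
Qed.

Lemma expand_differentiable F (L : {linear V -> W}) x : continuous L ->
  (forall e : R, 0 < e ->
    \forall h \near (0 : V), `|F (x + h) - F x - L h| <= e * `|h|) ->
  is_diff x F L.
Proof.
move=> cL exF.
have E : F \o shift x = cst (F x) + L +o_ (0 : V) id.
  apply/eqaddoP => e e0; move: (exF e e0); apply: filterS => h.
  suff -> : F (x + h) - F x - L h = (F \o +%R^~ x - (cst (F x) + L)) h by [].
  by rewrite !fctE /= opprD addrA [h + x]addrC.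
have dL := diff_unique cL E.
by split => //; apply/diff_locallyP; rewrite dL.
Qed.

Lemma near0_norm_le (e : R) : 0 < e -> \forall h \near (0 : V), `|h| <= e.
Proof.
move=> e0; apply/nbhs_normP; exists e => // h /=.
by rewrite sub0r normrN => /ltW.
Qed.

End Expansion.

Section ScalarContinuity.
Variables (R : realType) (V : normedModType R).
Implicit Types (F : V -> R) (x : V).

Lemma continuous_near_lt F x (l : R) : {for x, continuous F} -> F x < l ->
  \forall y \near x, F y < l.
Proof. by move=> cF Fl; apply: (cvgr_lt (F x)). Qed.

Lemma continuous_near_gt F x (l : R) : {for x, continuous F} -> l < F x ->
  \forall y \near x, l < F y.
Proof. by move=> cF Fl; apply: (cvgr_gt (F x)). Qed.

Lemma continuous_atP F x :
  (forall e : R, 0 < e -> \forall y \near x, `|F x - F y| <= e) ->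
  {for x, continuous F}.
Proof. by move=> h; apply/cvgrPdist_le. Qed.

Lemma continuous_at_dist F x : {for x, continuous F} ->
  forall e : R, 0 < e -> \forall y \near x, `|F x - F y| <= e.
Proof. by move=> /cvgrPdist_le. Qed.

End ScalarContinuity.

Section Derivatives.
Variables (R : realType) (n : nat).
Notation V := 'cV[R]_n.
Implicit Types (f : V -> R) (u x : V).

(** On differentiable functions, the differential is the inner product with the
    vector of partial derivatives. *)
Lemma diff_gradient f x u : differentiable f x -> 'd f x u = dot (gradient f x) u.
Proof.
move=> df.
rewrite [in LHS](matrix_sum_delta u) dotE linear_sum; apply: eq_bigr => i _.
by rewrite big_ord1 linearZ /= mxE deriveE// mulrC.
Qed.

Lemma diff_hessian f x u :
  differentiable (gradient f) x -> 'd (gradient f) x u = hessian f x *m u.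
Proof.
move=> df.
rewrite [in LHS](matrix_sum_delta u) linear_sum.
apply/colP => i; rewrite summxE mxE; apply: eq_bigr => j _.
rewrite big_ord1 linearZ /= mxE mulrC; congr (_ * _).
rewrite -deriveE// [RHS]mxE.
by rewrite derive_mx ?mxE//; exact: diff_derivable.
Qed.

Lemma expand_gradient f x (G : V) :
  (forall e : R, 0 < e ->
    \forall h \near (0 : V), `|f (x + h) - f x - dot G h| <= e * `|h|) ->
  differentiable f x /\ gradient f x = G.
Proof.
move=> ex.
have lin : linear (dot G) by move=> k u w; rewrite dotDr dotZr.
pose sxlM := GRing.isLinear.Build _ _ _ _ _ lin.
pose L : {linear V -> R} := HB.pack (dot G) sxlM.
have cL : continuous L.
  apply: bounded_linear_continuous; apply/linear_boundedP.
  exists (n%:R * `|G|); split; first exact: num_real.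
  move=> k kG u /=; apply: le_trans (norm_dot _ _) _.
  by apply: ler_wpM2r => //; exact: ltW.
have [df dfE] := @expand_differentiable _ _ _ f L x cL ex.
split => //; apply/colP => i; rewrite mxE deriveE// dfE/=.
exact: dot_delta.
Qed.

Lemma differentiable_cV m (F : V -> 'cV[R]_m) x :
  (forall i, differentiable (fun y => F y i 0) x) -> differentiable F x.
Proof.
move=> dF.
have -> : F = \sum_(i < m) (fun y => F y i 0 *: delta_mx i 0).
  apply/funext => y; rewrite fct_sumE {1}[F y]matrix_sum_delta.
  by apply: eq_bigr => i _; rewrite big_ord1.
by apply: differentiable_sum => i; apply: differentiableZl.
Qed.

Lemma differentiable_entry m (F : V -> 'cV[R]_m) x i :
  differentiable F x -> differentiable (fun y => F y i 0) x.
Proof.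
move=> dF; apply: (@differentiable_comp _ _ _ _ F (fun M => M i 0)) => //.
exact: differentiable_coord.
Qed.

End Derivatives.

(** * Symmetry of second derivatives and Taylor estimates *)

Section Taylor.
Variables (R : realType) (n : nat).
Notation V := 'cV[R]_n.
Implicit Types (f : V -> R) (u w x y d : V).

Lemma mean_value (psi dpsi : R -> R) (a b : R) : a < b ->
  (forall s, a <= s <= b -> is_derive s 1 psi (dpsi s)) ->
  exists2 c, a < c < b & psi b - psi a = dpsi c * (b - a).
Proof.
move=> ab dp.
have [s sab|c|c] := @MVT _ psi dpsi a b ab.
- by apply: dp; move: sab; rewrite in_itv/= => /andP[/ltW-> /ltW->].
- apply: derivable_within_continuous => s; rewrite in_itv/= => sab.
  by have := dp _ sab.
- by rewrite in_itv/=; exists c.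
Qed.

Lemma is_diff_line x u (s : R) :
  is_diff s (fun t : R => x + t *: u) (fun t : R => t *: u).
Proof.
have : is_diff s (cst x + ( *:%R^~ u)) (0 + ( *:%R^~ u)).
  exact: is_diffD.
by rewrite add0r.
Qed.

Lemma is_derive_line f x u (s : R) : differentiable f (x + s *: u) ->
  is_derive s 1 (fun t : R => f (x + t *: u)) (dot (gradient f (x + s *: u)) u).
Proof.
move=> df.
have dl := is_diff_line x u s.
have dc : differentiable (f \o (fun t : R => x + t *: u)) s.
  by apply: differentiable_comp.
split; first exact: diff_derivable.
rewrite deriveE// diff_comp//= diff_val scale1r.
exact: diff_gradient.
Qed.

Lemma is_derive_gradient_line f x u w (s : R) :
  differentiable (gradient f) (x + s *: u) ->
  is_derive s 1 (fun t : R => dot w (gradient f (x + t *: u)))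
    (dot w (hessian f (x + s *: u) *m u)).
Proof.
move=> df.
have dl := is_diff_line x u s.
have dN : differentiable (gradient f \o (fun t : R => x + t *: u)) s.
  by apply: differentiable_comp.
have dd : 'd (gradient f \o (fun t : R => x + t *: u)) s 1 = hessian f (x + s *: u) *m u.
  by rewrite diff_comp//= diff_val scale1r diff_hessian.
have -> : (fun t : R => dot w (gradient f (x + t *: u))) =
   \sum_(i < n) (w i 0 *: (fun t => gradient f (x + t *: u) i 0)).
  by apply/funext => t; rewrite dotE fct_sumE.
rewrite dotE; apply: is_derive_sum => i; apply: is_deriveZ.
have dc : differentiable ((fun M : V => M i 0) \o (gradient f \o (fun t : R => x + t *: u))) s.
  by apply: differentiable_comp => //; exact: differentiable_coord.
have -> : (hessian f (x + s *: u) *m u) i 0 =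
  'D_1 (fun t : R => gradient f (x + t *: u) i 0) s.
  rewrite -dd -deriveE// derive_mx ?mxE//; exact: diff_derivable.
by split => //; exact: diff_derivable.
Qed.

(** For f with a gradient differentiable at x, the second difference of f at x in
    the directions u and w is s^2 u^T D^2f(x) w + o(s^2). Its symmetry in u and w
    gives Young's theorem. *)
Lemma second_difference f x u w : twice_differentiable f x ->
  forall e : R, 0 < e -> \forall s \near (0 : R)^'+,
  `|f (x + s *: u + s *: w) - f (x + s *: u) - f (x + s *: w) + f x
     - s ^+ 2 * dot u (hessian f x *m w)| <= e * s ^+ 2.
Proof.
move=> [df dg] e e0.
(* N s bounds the norm of all the increments; C absorbs the constants that
   multiply the error of the first order expansion of the gradient. *)
pose N : R := 1 + `|u| + `|w|.
have N0 : 0 < N by rewrite ltr_wpDr// ltr_wpDr.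
pose C : R := 1 + n%:R * `|u| * (2 * N).
have C0 : 0 < C by rewrite ltr_wpDr// !mulr_ge0// ltW.
have eC : 0 < e / C by rewrite divr_gt0.
have := differentiable_expand dg eC.
move=> /nbhs_normP[r1 /= r10 ex1].
move: df => /nbhs_normP[r2 /= r20 ex2].
have r0 : 0 < Num.min r1 r2 / N by rewrite divr_gt0// lt_min r10.
near=> s.
have s0 : 0 < s by near: s; exact: nbhs_right_gt.
have sr : s < Num.min r1 r2 / N by near: s; exact: nbhs_right_lt.
have small h (t : R) (k : R) : 0 <= t <= s -> 0 <= k <= s -> h = t *: u + k *: w ->
    [/\ `|h| <= N * s, `|h| < r1 & `|h| < r2].
  move=> ts ks ->.
  have hN : `|t *: u + k *: w| <= N * s.
    apply: le_trans (ler_normD _ _) _; rewrite !normrZ.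
    case/andP: ts => t0 ts; case/andP: ks => k0 ks.
    rewrite (ger0_norm t0) (ger0_norm k0) /N !mulrDl mul1r.
    rewrite -[leLHS]add0r addrA; apply: lerD; last by rewrite mulrC ler_wpM2l.
    by apply: lerD; [exact: ltW|rewrite mulrC ler_wpM2l].
  move: sr; rewrite ltr_pdivlMr// mulrC lt_min => /andP[s1 s2].
  by split => //; exact: le_lt_trans hN _.
have dfx h t k : 0 <= t <= s -> 0 <= k <= s -> h = t *: u + k *: w ->
    differentiable f (x + h).
  by move=> ts ks hE; apply: ex2; rewrite /= opprD addNKr normrN; case: (small h t k).
have gx h t k : 0 <= t <= s -> 0 <= k <= s -> h = t *: u + k *: w ->
    `|gradient f (x + h) - gradient f x - hessian f x *m h| <= e / C * (N * s).
  move=> ts ks hE; have [h1 h2 h3] := small h t k ts ks hE.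
  rewrite -diff_hessian//; apply: le_trans (ex1 _ _) _ => /=.
    by rewrite sub0r normrN.
  by apply: ler_wpM2l => //; exact: ltW.
have ss : 0 <= s <= s by rewrite lexx ltW.
have s00 : 0 <= (0 : R) <= s by rewrite lexx ltW.
pose psi t := f (x + s *: w + t *: u) - f (x + t *: u).
pose dpsi t := dot (gradient f (x + s *: w + t *: u)) u - dot (gradient f (x + t *: u)) u.
have [t ts|c /andP[c0 cs]] := @mean_value psi dpsi 0 s s0.
  apply: is_deriveB; apply: is_derive_line.
    by rewrite -addrA; apply: (dfx _ t s) => //; rewrite addrC.
  by apply: (dfx _ t 0) => //; rewrite scale0r addr0.
rewrite /psi !scale0r !addr0 subr0 => psiE.
have -> : f (x + s *: u + s *: w) - f (x + s *: u) - f (x + s *: w) + f x =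
    dpsi c * s by rewrite -psiE [x + _ + _]addrAC; ring.
have cc : 0 <= c <= s by rewrite !ltW.
have g1 := gx _ c s cc ss (erefl _).
have g2 := gx _ c 0 cc s00 (erefl _).
rewrite scale0r addr0 in g2.
rewrite expr2 -mulrA mulrC -mulrBr normrM (gtr0_norm s0) -/s.
rewrite [leRHS]mulrCA; apply: ler_wpM2l; first exact: ltW.
have -> : dpsi c - s * dot u (hessian f x *m w) =
   dot u ((gradient f (x + (c *: u + s *: w)) - gradient f x - hessian f x *m (c *: u + s *: w))
    - (gradient f (x + c *: u) - gradient f x - hessian f x *m (c *: u))).
  rewrite /dpsi [c *: u + _]addrC addrA ![dot _ u]dotC.
  rewrite mulmxDr -!scalemxAr !(dotDr, dotNr, dotZr).
  by ring.
apply: le_trans (norm_dot _ _) _.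
apply: (@le_trans _ _ (n%:R * `|u| * (2 * (e / C * (N * s))))).
  apply: ler_wpM2l; first exact: mulr_ge0.
  by apply: le_trans (ler_normB _ _) _; lra.
have -> : n%:R * `|u| * (2 * (e / C * (N * s))) = e * s * ((C - 1) / C).
  by rewrite /C; ring.
rewrite -[leRHS]mulr1; apply: ler_wpM2l; first by rewrite mulr_ge0 ?ltW.
by rewrite ler_pdivrMr// mul1r gerDl lerN10.
Unshelve. all: by end_near. Qed.

Lemma hessian_sym f x : twice_differentiable f x -> (hessian f x)^T = hessian f x.
Proof.
move=> tf.
have E u w : dot u (hessian f x *m w) = dot w (hessian f x *m u).
  apply/eqP; rewrite -subr_eq0 -normr_le0; apply/ler_addgt0Pr => e e0.
  rewrite add0r.
  have e2 : 0 < e / 2 by rewrite divr_gt0.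
  near (0 : R)^'+ => s.
  have s0 : 0 < s by near: s; exact: nbhs_right_gt.
  have : `|f (x + s *: u + s *: w) - f (x + s *: u) - f (x + s *: w) + f x
     - s ^+ 2 * dot u (hessian f x *m w)| <= e / 2 * s ^+ 2.
    by near: s; exact: second_difference.
  have : `|f (x + s *: w + s *: u) - f (x + s *: w) - f (x + s *: u) + f x
     - s ^+ 2 * dot w (hessian f x *m u)| <= e / 2 * s ^+ 2.
    by near: s; exact: second_difference.
  rewrite [x + s *: w + _]addrAC.
  set A := f _; set B := f _; set C := f _; set D := f x; set p := dot _ _; set q := dot _ _.
  move=> h1 h2.
  have s20 : 0 < s ^+ 2 by rewrite exprn_gt0.
  rewrite -(ler_pM2r s20) -{1}(gtr0_norm s20) -normrM.
  have -> : (q - p) * s ^+ 2 = (A - B - C + D - s ^+ 2 * p) - (A - C - B + D - s ^+ 2 * q) by ring.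
  by apply: le_trans (ler_normB _ _) _; lra.
apply/matrixP => i j; rewrite mxE -[LHS]dot_delta_mulmx -[RHS]dot_delta_mulmx.
exact: E.
Unshelve. all: by end_near. Qed.

Variables (f : V -> R) (H : 'M[R]_n) (e : R) (x d : V).
Hypothesis seg : forall s : R, 0 <= s <= 1 ->
  twice_differentiable f (x + s *: d) /\ `|hessian f (x + s *: d) - H| <= e.

(** Along a segment where the Hessian of f is e-close to H, the gradient and the
    values of f are those of a quadratic function of Hessian H up to terms
    controlled by e. *)
Lemma taylor_gradient : 0 <= e ->
  `|gradient f (x + d) - gradient f x - H *m d| <= n%:R * e * `|d|.
Proof.
move=> e0; apply: norm_le_entries => [|i j]; first by rewrite !mulr_ge0.
rewrite ord1 -dot_delta dotC; set w := delta_mx _ _.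
have [s s01|c /andP[c0 c1]] := 
  @mean_value (fun s => dot w (gradient f (x + s *: d)))
    (fun s => dot w (hessian f (x + s *: d) *m d)) 0 1 ltr01.
  by apply: is_derive_gradient_line; have [[]] := seg s01.
have [|_ hc] := @seg c; first by rewrite !ltW.
rewrite scale1r scale0r addr0 subr0 mulr1 !dotBr => ->.
rewrite -dotBr -mulmxBl dotC dot_delta.
apply: le_trans (entry_le_norm _ _ _) _; apply: le_trans (norm_mulmx _ _) _.
by apply: ler_wpM2r => //; apply: ler_wpM2l.
Qed.

End Taylor.

Lemma taylor_second_order (R : realType) (n : nat) (f : 'cV[R]_n -> R)
    (H : 'M[R]_n) (e : R) (x d : 'cV[R]_n) : 0 <= e ->
  (forall s : R, 0 <= s <= 1 ->
    twice_differentiable f (x + s *: d) /\ `|hessian f (x + s *: d) - H| <= e) ->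
  `|f (x + d) - f x - dot (gradient f x) d - 2^-1 * dot d (H *m d)|
    <= n%:R ^+ 2 * e * `|d| ^+ 2.
Proof.
move=> e0 seg.
pose psi s := f (x + s *: d) - s * dot (gradient f x) d - s ^+ 2 * (2^-1 * dot d (H *m d)).
pose dpsi s := dot (gradient f (x + s *: d)) d - dot (gradient f x) d - s * dot d (H *m d).
have [s s01|c /andP[c0 c1]] := @mean_value R psi dpsi 0 1 ltr01.
  apply: is_deriveB; first apply: is_deriveB.
  - by apply: is_derive_line; have [[/nbhs_singleton]] := seg _ s01.
  - have : is_derive s 1 ((id : R -> R) * cst (dot (gradient f x) d)) (s *: 0 + dot (gradient f x) d *: 1).
      exact: is_deriveM.
    by rewrite scaler0 add0r [_ *: 1]mulr1.
  - set q := dot d _.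
    have : is_derive s 1 ((id : R -> R) ^+ 2 * cst (2^-1 * q)) (s ^+ 2 *: 0 + (2^-1 * q) *: ((2%:R * s ^+ 1) *: 1)).
      apply: is_deriveM.
    rewrite scaler0 add0r [_ *: 1]mulr1 expr1 [_ *: _]mulrC.
    rewrite [2%:R * s * _](_ : _ = s * q) //.
    by field.
rewrite /psi !scale0r scale1r addr0 mul0r expr0n mul0r !subr0 expr1n !mul1r mulr1.
have -> : forall a b c d : R, a - b - c - d = a - d - b - c by move=> *; ring.
move=> ->; rewrite /dpsi.
have c01 : 0 <= c <= 1 by rewrite !ltW.
have -> : dot (gradient f (x + c *: d)) d - dot (gradient f x) d - c * dot d (H *m d) =
   dot (gradient f (x + c *: d) - gradient f x - H *m (c *: d)) d.
  by rewrite -scalemxAr !(dotBl, dotZl) [dot (H *m d) d]dotC.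
apply: le_trans (norm_dot _ _) _.
have seg' s : 0 <= s <= 1 -> twice_differentiable f (x + s *: (c *: d)) /\ `|hessian f (x + s *: (c *: d)) - H| <= e.
  move=> /andP[s0 s1]; rewrite scalerA; apply: seg; rewrite mulr_ge0 ?(ltW c0)//=.
  by apply: mulr_ile1 => //; exact: ltW.
have := taylor_gradient seg' e0.
set G := `|gradient _ _ - _ - _| => hG.
apply: (@le_trans _ _ (n%:R * (n%:R * e * `|d|) * `|d|)); last first.
  by rewrite le_eqVlt; apply/orP; left; apply/eqP; ring.
apply: ler_wpM2r => //; apply: ler_wpM2l => //.
apply: le_trans hG _; apply: ler_wpM2l; first exact: mulr_ge0.
by rewrite normrZ (ger0_norm (ltW c0)) ler_piMl // ltW.
Qed.

(** * Quadratic forms of index one *)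

Section QuadraticForms.
Variables (R : realType) (n : nat).
Notation V := 'cV[R]_n.
Implicit Types (A H : 'M[R]_n) (u w z q : V).

Lemma dot_eq0 u : (dot u u == 0) = (u == 0).
Proof.
apply/eqP/eqP => [u0|->]; last exact: dot0l.
apply/eqP; rewrite -normr_le0; apply: le_trans (norm_le_enorm _) _.
by rewrite enormE u0 sqrtr0.
Qed.

Lemma dot_gt0 u : u != 0 -> 0 < dot u u.
Proof. by move=> u0; rewrite lt_def dot_ge0 dot_eq0 u0. Qed.

Lemma normsq_le_dot u : `|u| ^+ 2 <= dot u u.
Proof. by rewrite -enorm_sqr lerXn2r ?nnegrE ?enorm_ge0 ?norm_le_enorm. Qed.

Lemma quadratic_gradient A z (c : R) x :
  differentiable (fun u => dot (u - z) (A *m (u - z)) + c) x /\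
  gradient (fun u => dot (u - z) (A *m (u - z)) + c) x = (A + A^T) *m (x - z).
Proof.
apply: expand_gradient => e e0.
pose C : R := 1 + n%:R ^+ 2 * `|A|.
have C0 : 0 < C by rewrite ltr_wpDr// mulr_ge0// exprn_ge0.
near=> h.
have -> : x + h - z = x - z + h by rewrite addrAC.
have -> : dot (x - z + h) (A *m (x - z + h)) + c - (dot (x - z) (A *m (x - z)) + c)
    - dot ((A + A^T) *m (x - z)) h = dot h (A *m h).
  move: (x - z) => w; rewrite !mulmxDr mulmxDl !(dotDl, dotDr).
  rewrite [dot (A^T *m w) h]dot_mulmx trmxK [dot (A *m w) h]dotC; ring.
apply: le_trans (norm_dot_mulmx _ _ _) _; apply: ler_wpM2r => //.
apply: (@le_trans _ _ (C * `|h|)).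
  by apply: ler_wpM2r => //; rewrite /C lerDr.
rewrite mulrC -ler_pdivlMr//; near: h.
have sm := @near0_norm_le R V _ (divr_gt0 e0 C0).
exact: sm.
Unshelve. all: by end_near. Qed.

Lemma quadratic_continuous A : continuous (fun u => dot u (A *m u)).
Proof.
move=> x; have [+ _] := quadratic_gradient A 0 0 x.
by under eq_fun do rewrite addr0 subr0; exact: differentiable_continuous.
Qed.

Lemma quadratic_hessian A z (c : R) x :
  twice_differentiable (fun u => dot (u - z) (A *m (u - z)) + c) x /\
  hessian (fun u => dot (u - z) (A *m (u - z)) + c) x = A + A^T.
Proof.
set F := fun u => _.
have gE : gradient F = fun y => (A + A^T) *m (y - z).
  by apply/funext => y; have [] := quadratic_gradient A z c y.
have dg : is_diff x (gradient F) (mulmx (A + A^T)).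
  rewrite gE; apply: expand_differentiable.
    apply: bounded_linear_continuous; apply/linear_boundedP.
    exists (n%:R * `|A + A^T|); split; first exact: num_real.
    move=> k kG u /=; apply: le_trans (norm_mulmx _ _) _.
    by apply: ler_wpM2r => //; exact: ltW.
  move=> e e0; near=> h.
  have -> : x + h - z = x - z + h by rewrite addrAC.
  rewrite mulmxDr [(A + A^T) *m (x - z) + _]addrC addrK.
  rewrite -[X in _ - X]/((A + A^T) *m h).
  by rewrite subrr normr0 mulr_ge0// ltW.
split.
  split; last by [].
  by near=> y; have [] := quadratic_gradient A z c y.
apply/matrixP => i j; rewrite -dot_delta_mulmx dotC dot_delta.
by rewrite -diff_hessian// diff_val -[RHS]dot_delta_mulmx dotC dot_delta.
Unshelve. all: by end_near. Qed.

Lemma dot_continuous w : continuous (dot w).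
Proof.
move=> x; apply: differentiable_continuous.
have [] // := @expand_gradient _ _ (dot w) x w.
move=> e e0; near=> h.
rewrite dotDr.
have -> : dot w x + dot w h - dot w x - dot w h = 0 by ring.
by rewrite normr0 mulr_ge0// ltW.
Unshelve. all: by end_near.
Qed.

Lemma trmx_continuous m p : continuous (fun u : 'M[R]_(m, p) => u^T).
Proof.
apply: (@bounded_linear_continuous _ _ _ (@trmx R m p)).
apply/linear_boundedP; exists 1; split; first exact: num_real.
by move=> k k1 u /=; rewrite norm_trmx ler_peMl // ltW.
Qed.

(** A quadratic form attains its minimum on the unit sphere of a hyperplane. *)
Lemma rayleigh_min A w z : dot w z = 0 -> z != 0 ->
  exists u0, [/\ dot w u0 = 0, dot u0 u0 = 1 &
    forall u, dot w u = 0 -> dot u0 (A *m u0) * dot u u <= dot u (A *m u)].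
Proof.
move=> wz z0.
have ctr : continuous (fun r : 'rV[R]_n => r^T) by exact: trmx_continuous.
pose S : set 'rV[R]_n := [set r | dot w r^T = 0] `&` [set r | dot r^T (1%:M *m r^T) = 1].
have cA B : continuous (fun r : 'rV[R]_n => dot r^T (B *m r^T)).
  move=> r; apply: (@continuous_comp _ _ _ (fun r : 'rV[R]_n => r^T)
    (fun u => dot u (B *m u))); [exact: ctr|exact: quadratic_continuous].
have normalize u : dot w u = 0 -> u != 0 -> S ((enorm u)^-1 *: u)^T.
  move=> wu u0; split => /=; rewrite trmxK ?dotZr ?wu ?mulr0//.
  rewrite mul1mx dotZl dotZr -enorm_sqr expr2 mulrA mulrA -mulrA -expr2.
  rewrite -expr2 -exprMn mulVf ?expr1n// enormE gt_eqF// sqrtr_gt0.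
  exact: dot_gt0.
have clS : closed S.
  apply: closedI.
    apply: (@closed_comp _ _ (fun r : 'rV[R]_n => dot w r^T) [set 0]).
      move=> r _; apply: (@continuous_comp _ _ _ (fun r : 'rV[R]_n => r^T) (dot w)).
        exact: ctr.
      exact: dot_continuous.
    exact: closed_eq.
  apply: (@closed_comp _ _ (fun r : 'rV[R]_n => dot r^T (1%:M *m r^T)) [set 1]).
    by move=> r _; exact: cA.
  exact: closed_eq.
have bS : bounded_set S.
  exists 1; split; first exact: num_real.
  move=> k k1 r [_ /= r1]; apply: le_trans (ltW k1).
  rewrite -norm_trmx; apply: le_trans (norm_le_enorm _) _.
  by rewrite enormE -[X in dot _ X]mul1mx r1 sqrtr1.
have cS : compact S by exact: bounded_closed_compact.
have S0 : S !=set0 by exists ((enorm z)^-1 *: z)^T; exact: normalize.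
have [r rS rmin] := @EVT_min_rV R n (fun r => dot r^T (A *m r^T)) S S0 cS
  (continuous_subspaceT (cA A)).
move: rS; rewrite inE => -[/= wr r1]; rewrite mul1mx in r1.
exists r^T; split => // u wu.
have [->|u0] := eqVneq u 0; first by rewrite !dot0l mulr0.
have := rmin _ (mem_set (normalize _ wu u0)).
have u1 : 0 < enorm u by rewrite enormE sqrtr_gt0 dot_gt0.
rewrite trmxK -scalemxAr dotZl dotZr mulrA -expr2 exprVn.
by rewrite mulrC ler_pdivlMr ?exprn_gt0// enorm_sqr.
Qed.

(** A minimiser on the orthogonal complement of an eigenvector is itself an
    eigenvector. *)
Lemma rayleigh_eigen A (lambda : R) w u0 : A^T = A -> A *m w = lambda *: w ->
  dot w u0 = 0 -> dot u0 u0 = 1 ->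
  (forall u, dot w u = 0 -> dot u0 (A *m u0) * dot u u <= dot u (A *m u)) ->
  A *m u0 = dot u0 (A *m u0) *: u0.
Proof.
move=> As Aw wu0 u01; set mu := dot u0 (A *m u0) => mumin.
have [r rE] : exists r, r = A *m u0 - mu *: u0 by eexists.
have wr : dot w r = 0.
  by rewrite rE dotBr dotZr wu0 mulr0 subr0 dot_sym// Aw dotZr dotC wu0 mulr0.
suff : r == 0 by rewrite rE subr_eq0 => /eqP.
rewrite -dot_eq0 eq_le dot_ge0 andbT leNgt; apply/negP => P0.
set P := dot r r in P0.
pose q := dot r (A *m r) - mu * P.
(* u0 - s r stays in the hyperplane, and the term linear in s is - 2 P s. *)
have key (s : R) : 0 <= - (2 * P * s) + q * s ^+ 2.
  have := mumin (u0 - s *: r); rewrite dotBr dotZr wu0 wr mulr0 subr0 => /(_ erefl).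
  rewrite -subr_ge0; congr (_ <= _).
  rewrite mulmxBr -scalemxAr !(dotBl, dotBr, dotZl, dotZr) u01 -/P.
  have -> : dot u0 (A *m r) = dot r (A *m u0) by exact: dot_sym.
  have E : dot r (A *m u0) = P + mu * dot r u0.
    rewrite /P -[in RHS]dotZr -dotDr; congr (dot _ _).
    by rewrite rE subrK.
  rewrite E [dot u0 r]dotC /q -/mu; ring.
have q1 : 0 < `|q| + 1 by rewrite ltr_wpDl.
have := key (P / (`|q| + 1)).
apply/negP; rewrite -ltNge.
set s := P / _.
have s0 : 0 < s by rewrite divr_gt0.
have Ps : P = s * (`|q| + 1) by rewrite /s divfK// gt_eqF.
rewrite Ps addrC subr_lt0.
have := ler_norm q; nra.
Qed.

Variables (H : 'M[R]_n) (lambda : R) (vbar v : V).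
Hypotheses (Hs : H^T = H) (Hu : H \in unitmx) (Hone : one_negative_eigenvalue H).
Hypotheses (lambda0 : lambda < 0) (Hvbar : H *m vbar = lambda *: vbar).
Hypothesis vbar0 : vbar != 0.

(** A form of index one is positive definite on the orthogonal complement of its
    negative eigenvector. *)
Lemma index1_pos_orthogonal u : dot vbar u = 0 -> u != 0 -> 0 < dot u (H *m u).
Proof.
move=> vu u0; rewrite ltNge; apply/negP => Hle.
have [u1 [vu1 u11 umin]] := rayleigh_min H vu u0.
have Hu1 := rayleigh_eigen Hs Hvbar vu1 u11 umin.
set mu := dot u1 (H *m u1) in Hu1 umin.
have u1n0 : u1 != 0 by apply/eqP => u1E; move: u11; rewrite u1E dot0l => /esym/eqP; rewrite oner_eq0.
have mule : mu <= 0.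
  have := le_trans (umin _ vu) Hle.
  by rewrite pmulr_lle0// dot_gt0.
have trE (k : R) x : H *m x = k *: x -> x^T *m H = k *: x^T.
  by move=> E; rewrite -[H]Hs -trmx_mul E linearZ.
have tn0 x : x != 0 -> x^T != 0.
  by apply: contra => /eqP E; rewrite -[x]trmxK E trmx0.
move: mule; rewrite le_eqVlt => /predU1P[mu0|mu0].
  by move/eqP: u1n0; apply; rewrite -[u1](mulKmx Hu) Hu1 mu0 scale0r mulmx0.
(* u1 would be a second eigenvector, orthogonal to vbar, for the simple negative
   eigenvalue. *)
have [a [a0 eva rka auniq]] := Hone.
have la : lambda = a.
  apply: auniq => //; apply/eigenvalueP; exists vbar^T; last exact: tn0.
  exact: trE.
have ma : mu = a.
  apply: auniq => //; apply/eigenvalueP; exists u1^T; last exact: tn0.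
  exact: trE.
have s1 : (vbar^T <= eigenspace H a)%MS by apply/eigenspaceP; rewrite -la; exact: trE.
have s2 : (u1^T <= eigenspace H a)%MS by apply/eigenspaceP; rewrite -ma; exact: trE.
have s3 : (eigenspace H a <= vbar^T)%MS.
  by rewrite -(geq_leqif (mxrank_leqif_sup s1)) rka lt0n mxrank_eq0 tn0.
have /sub_rVP[k uk] := submx_trans s2 s3.
have {}uk : u1 = k *: vbar by rewrite -[u1]trmxK uk linearZ /= trmxK.
move: vu1; rewrite uk dotZr => /eqP; rewrite mulf_eq0 dot_eq0 (negbTE vbar0) orbF => /eqP k0.
by move: u1n0; rewrite uk k0 scale0r eqxx.
Qed.

(** On the H-orthogonal complement of a negative direction of a form
    of index one, the form is positive definite. *)
Lemma index1_pos : dot v (H *m v) < 0 ->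
  forall q, dot v (H *m q) = 0 -> q != 0 -> 0 < dot q (H *m q).
Proof.
move=> vv q vq q0; rewrite ltNge; apply/negP => qq.
(* The form is nonpositive on the plane of v and q, which meets the orthogonal
   complement of vbar at z. *)
pose z := dot vbar q *: v - dot vbar v *: q.
have vz : dot vbar z = 0 by rewrite dotBr !dotZr mulrC subrr.
have qv : dot q (H *m v) = 0 by rewrite dot_sym.
have z0 : z = 0.
  apply/eqP; apply/negPn/negP => /(index1_pos_orthogonal vz); apply/negP.
  rewrite -leNgt /z mulmxBr -!scalemxAr !(dotBl, dotBr, dotZl, dotZr) vq qv.
  rewrite !mulr0 subr0 sub0r mulrN opprK.
  rewrite -[leRHS]addr0; apply: lerD.
    by rewrite mulrA -expr2 mulr_ge0_le0// ?sqr_ge0// ltW.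
  by rewrite mulrA -expr2 mulr_ge0_le0// sqr_ge0.
have : dot v (H *m z) = 0 by rewrite z0 mulmx0 dot0r.
rewrite /z mulmxBr -!scalemxAr dotBr !dotZr vq mulr0 subr0 => /eqP.
rewrite mulf_eq0 (lt_eqF vv) orbF => /eqP bq.
by have := index1_pos_orthogonal bq q0; rewrite ltNge qq.
Qed.

Lemma index1_coercive : dot v (H *m v) < 0 ->
  exists2 c : R, 0 < c & forall q, dot v (H *m q) = 0 -> c * `|q| ^+ 2 <= dot q (H *m q).
Proof.
move=> vv.
have sw q : dot v (H *m q) = dot (H *m v) q by rewrite dot_mulmx Hs.
have [[z [vz z0]]|nz] := pselect (exists z, dot v (H *m z) = 0 /\ z != 0); last first.
  exists 1 => // q vq; have [->|q0] := eqVneq q 0.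
    by rewrite normr0 expr0n mulr0 dot0l.
  by exfalso; apply: nz; exists q.
rewrite sw in vz.
have [u0 [vu0 u01 umin]] := rayleigh_min H vz z0.
exists (dot u0 (H *m u0)).
  apply: index1_pos => //; first by rewrite sw.
  by rewrite -dot_eq0 u01 oner_eq0.
move=> q; rewrite sw => vq; apply: le_trans (umin _ vq).
apply: ler_wpM2l; last exact: normsq_le_dot.
rewrite ltW//; apply: index1_pos => //; first by rewrite sw.
by rewrite -dot_eq0 u01 oner_eq0.
Qed.

End QuadraticForms.

(** * Perturbation of the model Hessian *)

Section ModelHessian.
Variables (R : realType) (n : nat).
Notation V := 'cV[R]_n.

(** If f (x + T(x) v) is constant in x, the Hessian of T at x is
    [endpoint_hessian D A tau v], where tau is the gradient of T at x, and A and D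
    are the Hessian of f and its derivative along v at x + T(x) v. *)
Definition endpoint_hessian (D : R) (A : 'M[R]_n) (tau v : V) : 'M[R]_n :=
  - D^-1 *: ((1%:M + v *m tau^T)^T *m A *m (1%:M + v *m tau^T)).

(** The Hessian of T^2, T being a function with value g, gradient p and Hessian
    B. *)
Definition square_hessian (g : R) (p : V) (B : 'M[R]_n) : 'M[R]_n :=
  2 *: (p *m p^T) + (2 * g) *: B.

(** The Hessian of the squared parallel distance of the quadratic model, when
    a = - v^T H v. *)
Definition model_hessian (a : R) (H : 'M[R]_n) (v : V) : 'M[R]_n :=
  (8 / a ^+ 2) *: (H *m v *m v^T *m H + a *: H).

Lemma outer_mulmx (u w z : V) : u *m w^T *m z = dot w z *: u.
Proof. by rewrite -mulmxA [w^T *m z]mx11_scalar mul_mx_scalar. Qed.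

Lemma outer_entry (u w : V) i j : (u *m w^T) i j = u i 0 * w j 0.
Proof. by rewrite mxE big_ord1 mxE. Qed.

Lemma shear_mulmx (tau v u : V) : (1%:M + v *m tau^T) *m u = u + dot tau u *: v.
Proof. by rewrite mulmxDl mul1mx outer_mulmx. Qed.

Lemma conj_dot (A B : 'M[R]_n) u w :
  dot u ((B^T *m A *m B) *m w) = dot (B *m u) (A *m (B *m w)).
Proof. by rewrite -!mulmxA dot_mulmx. Qed.

Lemma conj_entry (A : 'M[R]_n) (tau v : V) i j :
  ((1%:M + v *m tau^T)^T *m A *m (1%:M + v *m tau^T)) i j =
  dot (delta_mx i 0 + tau i 0 *: v) (A *m (delta_mx j 0 + tau j 0 *: v)).
Proof. by rewrite -dot_delta_mulmx conj_dot !shear_mulmx !dot_delta. Qed.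

End ModelHessian.

Section Perturbation.
Variables (R : realType) (n : nat).
Notation V := 'cV[R]_n.
Variables (H : 'M[R]_n) (v : V) (a M : R).
Hypotheses (Hs : H^T = H) (a0 : 0 < a) (vHv : dot v (H *m v) = - a) (v1 : `|v| <= 1).
Hypotheses (M1 : 1 <= M) (HM : `|H| <= M).

Let q (tau : V) i : V := delta_mx i 0 + tau i 0 *: v.

Let norm_q tau i : `|tau| <= M -> `|q tau i| <= 2 * M.
Proof.
move=> tM; apply: le_trans (ler_normD _ _) _.
have : `|delta_mx i 0 : V| <= 1.
  apply: norm_le_entries => // k j; rewrite mxE; case: (_ && _) => /=.
    by rewrite normr1.
  by rewrite normr0 ler01.
have : `|tau i 0 *: v| <= M.
  rewrite normrZ -[leRHS]mulr1; apply: ler_pM => //.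
  exact: le_trans (entry_le_norm _ _ _) tM.
move: M1; lra.
Qed.

Let scaled_entry_close (A : 'M[R]_n) tau (k k0 e : R) i j : 0 <= e ->
  `|tau| <= M -> `|k| <= M -> `|k - k0| <= M * e -> `|A - H| <= e ->
  `|k * dot (q tau i) (A *m q tau j) - k0 * dot (q tau i) (H *m q tau j)|
   <= 8 * n%:R ^+ 2 * M ^+ 4 * e.
Proof.
move=> e0 tM kM kk AH.
have M0 : 0 <= M by apply: le_trans M1.
set b := dot _ _; set b0 := dot _ _.
have n2 : 0 <= n%:R ^+ 2 :> R by rewrite exprn_ge0.
have bb : `|b - b0| <= n%:R ^+ 2 * e * (2 * M) * (2 * M).
  rewrite /b /b0 -dotBr -mulmxBl; apply: le_trans (norm_dot_mulmx _ _ _) _.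
  apply: ler_pM => //; rewrite ?mulr_ge0//; last exact: norm_q.
  by apply: ler_pM => //; rewrite ?mulr_ge0//; [exact: ler_wpM2l|exact: norm_q].
have b0b : `|b0| <= n%:R ^+ 2 * M * (2 * M) * (2 * M).
  apply: le_trans (norm_dot_mulmx _ _ _) _.
  apply: ler_pM => //; rewrite ?mulr_ge0//; last exact: norm_q.
  by apply: ler_pM => //; rewrite ?mulr_ge0//; [exact: ler_wpM2l|exact: norm_q].
have -> : k * b - k0 * b0 = k * (b - b0) + (k - k0) * b0 by ring.
apply: le_trans (ler_normD _ _) _; rewrite !normrM.
have h1 : `|k| * `|b - b0| <= M * (n%:R ^+ 2 * e * (2 * M) * (2 * M)) by apply: ler_pM.
have h2 : `|k - k0| * `|b0| <= (M * e) * (n%:R ^+ 2 * M * (2 * M) * (2 * M)) by apply: ler_pM.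
apply: le_trans (lerD h1 h2) _.
rewrite -subr_ge0.
have -> : 8 * n%:R ^+ 2 * M ^+ 4 * e -
  (M * (n%:R ^+ 2 * e * (2 * M) * (2 * M)) +
   M * e * (n%:R ^+ 2 * M * (2 * M) * (2 * M))) = 4 * n%:R ^+ 2 * M ^+ 3 * e * (M - 1) by ring.
by rewrite !mulr_ge0 ?exprn_ge0// subr_ge0.
Qed.

(** If the two endpoints have almost opposite derivatives along v, the gradients
    of their parameters almost add up to the model value (2/a) H v, and the
    Hessians of f there are almost H, then the Hessian of the squared distance
    is almost that of the model: the contributions of the gradients cancel up
    to the square of the error in their sum. *)
Lemma square_hessian_close (A1 A2 : 'M[R]_n) (tau1 tau2 : V) (g D1 D2 e : R) :
  0 <= e <= 1 -> `|tau1| <= M -> `|tau2| <= M ->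
  `|g / D1| <= M -> `|g / D2| <= M ->
  `|g / D1 - 2 / a| <= M * e -> `|g / D2 - - (2 / a)| <= M * e ->
  `|tau1 + tau2 - (2 / a) *: (H *m v)| <= M * e ->
  `|A1 - H| <= e -> `|A2 - H| <= e ->
  `|square_hessian g (tau2 - tau1)
      (endpoint_hessian D2 A2 tau2 v - endpoint_hessian D1 A1 tau1 v)
    - model_hessian a H v| <= (32 * n%:R ^+ 2 * M ^+ 4 + 2 * M ^+ 2) * e.
Proof.
move=> /andP[e0 e1] t1 t2 k1M k2M k1 k2 st A1H A2H.
have M0 : 0 <= M by apply: le_trans M1.
apply: norm_le_entries => [|i j].
  by rewrite mulr_ge0// addr_ge0// !mulr_ge0// exprn_ge0.
have c1 := scaled_entry_close i j e0 t1 k1M k1 A1H.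
have c2 := scaled_entry_close i j e0 t2 k2M k2 A2H.
pose s := tau1 + tau2 - (2 / a) *: (H *m v).
(* s is the error in the sum of tau1 and tau2; it serves to eliminate tau2. *)
have sE k : tau2 k 0 = s k 0 + (2 / a) * (H *m v) k 0 - tau1 k 0.
  by rewrite /s !mxE; ring.
have sM k : `|s k 0| <= M * e by apply: le_trans (entry_le_norm _ _ _) st.
have entry : model_hessian a H v i j =
    (8 / a ^+ 2) * ((H *m v) i 0 * (H *m v) j 0 + a * H i j).
  rewrite mxE mxE; congr (_ * (_ + _)); last by rewrite mxE.
  by rewrite -mulmxA -{2}Hs -trmx_mul outer_entry.
have bE tau : dot (q tau i) (H *m q tau j) = H i j + tau j 0 * (H *m v) i 0
    + tau i 0 * (H *m v) j 0 - a * tau i 0 * tau j 0.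
  rewrite /q mulmxDr -scalemxAr !(dotDl, dotDr, dotZl, dotZr) vHv.
  rewrite dot_delta_mulmx [dot v _]dot_sym// ![dot (delta_mx _ _) _]dotC !dot_delta.
  by ring.
have eh D A tau : endpoint_hessian D A tau v i j = - D^-1 * dot (q tau i) (A *m q tau j).
  by rewrite /endpoint_hessian mxE conj_entry.
have lhs : (square_hessian g (tau2 - tau1)
      (endpoint_hessian D2 A2 tau2 v - endpoint_hessian D1 A1 tau1 v)) i j =
   2 * ((tau2 i 0 - tau1 i 0) * (tau2 j 0 - tau1 j 0))
   - 2 * (g / D2 * dot (q tau2 i) (A2 *m q tau2 j)
          - g / D1 * dot (q tau1 i) (A1 *m q tau1 j)).
  have mxB (A B : 'M[R]_n) : (A - B) i j = A i j - B i j by rewrite !mxE.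
  rewrite /square_hessian mxE mxE outer_entry [in X in _ + X]mxE mxB !eh.
  by rewrite [(tau2 - tau1) i 0]mxE [(- tau1) i 0]mxE [(tau2 - tau1) j 0]mxE [(- tau1) j 0]mxE; ring.
rewrite [X in `|X|]mxE [(- model_hessian _ _ _) i j]mxE lhs entry.
set B1 := dot _ (A1 *m _) in c1 *; set B2 := dot _ (A2 *m _) in c2 *.
set b2 := dot _ (H *m _) in c1; set b3 := dot _ (H *m _) in c2.
have main : 2 * ((tau2 i 0 - tau1 i 0) * (tau2 j 0 - tau1 j 0)) + 4 / a * (b2 + b3) -
   8 / a ^+ 2 * ((H *m v) i 0 * (H *m v) j 0 + a * H i j) = - 2 * (s i 0 * s j 0).
  rewrite /b2 /b3 !bE !sE; field; exact: lt0r_neq0.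
have -> : 2 * ((tau2 i 0 - tau1 i 0) * (tau2 j 0 - tau1 j 0)) - 2 * (g / D2 * B2 - g / D1 * B1) -
   8 / a ^+ 2 * ((H *m v) i 0 * (H *m v) j 0 + a * H i j) =
  2 * (g / D1 * B1 - 2 / a * b2) - 2 * (g / D2 * B2 - - (2 / a) * b3) + - 2 * (s i 0 * s j 0).
  by rewrite -main; ring.
apply: le_trans (ler_normD _ _) _.
have := ler_normB (2 * (g / D1 * B1 - 2 / a * b2)) (2 * (g / D2 * B2 - - (2 / a) * b3)).
rewrite ![`|2 * _|]normrM [`|- 2 * _|]normrM normrN (ger0_norm (ler0n _ 2)) normrM.
have ss : `|s i 0| * `|s j 0| <= M ^+ 2 * e.
  apply: (@le_trans _ _ ((M * e) * (M * e))); first exact: ler_pM.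
  have -> : (M * e) * (M * e) = M ^+ 2 * e * e by ring.
  by rewrite ler_piMr// mulr_ge0// exprn_ge0.
move: c1 c2 ss; set X1 := `|_ - _|; set X2 := `|_ - _|; set X3 := 8 * _ * _ * _.
set X4 := `|_ - _|; set X5 := _ * _; set X6 := M ^+ 2 * e.
have -> : (32 * n%:R ^+ 2 * M ^+ 4 + 2 * M ^+ 2) * e = 4 * X3 + 2 * X6.
  by rewrite /X3 /X6; ring.
lra.
Qed.

End Perturbation.

(** * Chords of an almost quadratic function *)

(** On U, the function f agrees with a quadratic function of Hessian H up to an
    error governed by e, at the orders zero, one and two. *)
Definition almost_quadratic (R : realType) (n : nat) (f : 'cV[R]_n -> R)
    (H : 'M[R]_n) (e : R) (U : set 'cV[R]_n) : Prop :=
  forall x d, U x -> U (x + d) ->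
  [/\ `|f (x + d) - f x - dot (gradient f x) d - 2^-1 * dot d (H *m d)| <= e * `|d| ^+ 2,
      `|gradient f (x + d) - gradient f x - H *m d| <= e * `|d| &
      `|hessian f x - H| <= e].

(** The gradient of the parameter T of an endpoint p = x + T(x) v of the chord
    cut out by a level set, as given by the implicit function theorem. *)
Definition endpoint_gradient (R : realType) (n : nat) (f : 'cV[R]_n -> R)
    (v p : 'cV[R]_n) : 'cV[R]_n :=
  - (dot (gradient f p) v)^-1 *: gradient f p.

(** A bound, depending only on the model, for the quantities attached to a chord:
    C bounds the norm of the gradient of f at the endpoints relative to the length
    of the chord, and the six terms of the sum are used for 1, H, the gradients of
    the endpoints, the quotients of the length by the slopes, the errors in these
    quotients, and the error in the sum of the two gradients. *)
Definition chord_bound (R : realType) (n : nat) (H : 'M[R]_n) (a c : R) : R :=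
  let C := (n%:R * `|H| + a) * (2 + 4 * a / c) in
  1 + `|H| + 4 * C / a + 4 / a + 8 / a ^+ 2 + (16 * C / a ^+ 2 + 2 / a).

Lemma chord_bound_ge (R : realType) (n : nat) (H : 'M[R]_n) (a c : R) :
  0 < a -> 0 < c -> 1 <= chord_bound H a c /\ `|H| <= chord_bound H a c.
Proof.
move=> a0 c0; rewrite /chord_bound.
have a0' := ltW a0; have c0' := ltW c0.
have ai : 0 <= a^-1 by rewrite invr_ge0.
have ci : 0 <= c^-1 by rewrite invr_ge0.
have H0 : 0 <= `|H| by [].
have : 0 <= (n%:R * `|H| + a) * (2 + 4 * a / c).
  by apply: mulr_ge0; apply: addr_ge0 => //; do ?apply: mulr_ge0.
set C := (_ + a) * _; move: C `|H| H0 => C h h0 C0.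
have w1 : 0 <= 4 * C / a by apply: mulr_ge0 => //; exact: mulr_ge0.
have w2 : 0 <= 4 / a by exact: mulr_ge0.
have w3 : 0 <= 8 / a ^+ 2 by rewrite -exprVn; apply: mulr_ge0 => //; exact: exprn_ge0.
have w4 : 0 <= 16 * C / a ^+ 2.
  by rewrite -exprVn; apply: mulr_ge0; [exact: mulr_ge0|exact: exprn_ge0].
have w5 : 0 <= 2 / a by exact: mulr_ge0.
by split; lra.
Qed.

Section Chord.
Variables (R : realType) (n : nat).
Notation V := 'cV[R]_n.
Variables (f : V -> R) (xbar v : V) (H : 'M[R]_n) (a c e l : R) (U : set V).
Hypotheses (f_aq : almost_quadratic f H e U) (Uxbar : U xbar).
Hypothesis crit : gradient f xbar = 0.
Hypotheses (a0 : 0 < a) (c0 : 0 < c) (e0 : 0 <= e).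
Hypotheses (vHv : dot v (H *m v) = - a) (v1 : `|v| <= 1).
Hypothesis coercive : forall q, dot v (H *m q) = 0 -> c * `|q| ^+ 2 <= dot q (H *m q).
Hypotheses (ea : e <= a / 8) (ec : e <= c / 4).

Lemma slice_expansion x (h : R) : U x -> U (x + h *: v) ->
  `|f (x + h *: v) - f x - h * dot (gradient f x) v + 2^-1 * a * h ^+ 2| <= e * h ^+ 2.
Proof.
move=> Ux Uxh; have [+ _ _] := f_aq Ux Uxh.
rewrite -scalemxAr !dotZl !dotZr vHv.
have -> : 2^-1 * (h * (h * - a)) = - (2^-1 * a * h ^+ 2) by field.
rewrite opprK => /le_trans; apply; apply: ler_wpM2l => //.
rewrite normrZ exprMn real_normK ?num_real// ler_piMr ?sqr_ge0//.
by rewrite exprn_ile1.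
Qed.

(** The foot on a line parallel to v of the H-orthogonal projection of xbar has
    f-value at least f xbar. *)
Lemma foot_value m : U m -> dot v (H *m (m - xbar)) = 0 ->
  f xbar + c / 4 * `|m - xbar| ^+ 2 <= f m.
Proof.
move=> Um vm; have := @f_aq xbar (m - xbar) Uxbar.
rewrite subrKC crit dot0l subr0 => /(_ Um) [h _ _].
have := coercive vm; move: h; rewrite ler_norml => /andP[h1 _] h2.
have h3 : e * `|m - xbar| ^+ 2 <= c / 4 * `|m - xbar| ^+ 2.
  by apply: ler_wpM2r => //; exact: sqr_ge0.
lra.
Qed.

Variables (p1 m : V) (g t : R).
Let p2 := p1 + g *: v.
Hypotheses (g0 : 0 < g) (Up1 : U p1) (Up2 : U p2) (Um : U m).
Hypotheses (fp1 : f p1 = l) (fp2 : f p2 = l) (lf : l <= f xbar).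
Hypotheses (mE : m = p1 + t *: v) (t0 : 0 <= t <= g).
Hypothesis vm : dot v (H *m (m - xbar)) = 0.

Let D1 := dot (gradient f p1) v.
Let D2 := dot (gradient f p2) v.

(** The slopes of f at the two ends of the chord are a g / 2 and - a g / 2 up to
    e g, as for a parabola of second derivative - a. *)
Lemma chord_slope1 : `|D1 - a / 2 * g| <= e * g.
Proof.
have := slice_expansion Up1 Up2; rewrite -/p2 fp1 fp2 subrr sub0r -/D1.
have -> : - (g * D1) + 2^-1 * a * g ^+ 2 = - (g * (D1 - a / 2 * g)) by ring.
have -> : e * g ^+ 2 = g * (e * g) by ring.
by rewrite normrN normrM (gtr0_norm g0) ler_pM2l.
Qed.

Lemma chord_slope2 : `|D2 + a / 2 * g| <= e * g.
Proof.
have E : p1 = p2 + (- g) *: v by rewrite /p2 scaleNr addrK.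
have := @slice_expansion p2 (- g) Up2; rewrite -E fp1 fp2 => /(_ Up1).
rewrite subrr sub0r -/D2 sqrrN.
have -> : - (- g * D2) + 2^-1 * a * g ^+ 2 = g * (D2 + a / 2 * g) by ring.
have -> : e * g ^+ 2 = g * (e * g) by ring.
by rewrite normrM (gtr0_norm g0) ler_pM2l.
Qed.

(** The chord cannot be short far from xbar: its length controls the distance
    from the foot to xbar, because f exceeds l at the foot by at least a multiple
    of the square of this distance, and by at most a multiple of the square of the
    length. *)
Lemma foot_dist : `|m - xbar| <= (1 + 4 * a / c) * g.
Proof.
have h1 := foot_value Um vm.
have Umt : U (p1 + t *: v) by rewrite -mE.
have := slice_expansion Up1 Umt.
rewrite -mE fp1 -/D1 ler_norml => /andP[_ h2].
have := chord_slope1; rewrite ler_norml => /andP[_ h3].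
case/andP: t0 => t00 tg.
have h4 : t * D1 <= g * ((a / 2 + e) * g).
  apply: (@le_trans _ _ (t * ((a / 2 + e) * g))).
    by apply: ler_wpM2l => //; lra.
  by apply: ler_wpM2r => //; rewrite mulr_ge0 ?ltW// ltr_wpDr// divr_gt0.
have h5 : e * t ^+ 2 <= e * g ^+ 2.
  by apply: ler_wpM2l => //; rewrite lerXn2r ?nnegrE// ltW.
have h6 : 0 <= 2^-1 * a * t ^+ 2 by rewrite mulr_ge0 ?sqr_ge0// mulr_ge0// ltW.
have h7 : e * g ^+ 2 <= a * g ^+ 2 / 8.
  by rewrite mulrAC; apply: ler_wpM2r => //; exact: sqr_ge0.
have h8 : c / 4 * `|m - xbar| ^+ 2 <= a * g ^+ 2.
  have E : g * ((a / 2 + e) * g) = a * g ^+ 2 / 2 + e * g ^+ 2 by ring.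
  rewrite E in h4.
  have G0 : 0 <= a * g ^+ 2 by rewrite mulr_ge0 ?sqr_ge0// ltW.
  have lin (F Fx Q L TD T G eT eG : R) : Fx + Q <= F -> F - L - TD + T <= eT ->
    TD <= G / 2 + eG -> eT <= eG -> 0 <= T -> eG <= G / 8 -> 0 <= G -> L <= Fx -> Q <= G.
    by move=> *; lra.
  exact: lin h1 h2 h4 h5 h6 h7 G0 lf.
have k0 : 0 <= 4 * a / c by rewrite divr_ge0 ?mulr_ge0// ltW.
rewrite -(@ler_pXn2r _ 2) ?nnegrE//; last by rewrite mulr_ge0 ?addr_ge0// ltW.
apply: (@le_trans _ _ (4 * a / c * g ^+ 2)).
  rewrite -(@ler_pM2l _ (c / 4)) ?divr_gt0//; apply: le_trans h8 _.
  by rewrite le_eqVlt; apply/orP; left; apply/eqP; field; exact: lt0r_neq0.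
rewrite exprMn; apply: ler_wpM2r; first exact: sqr_ge0.
set k := 4 * a / c in k0 *; nra.
Qed.

Let C := (n%:R * `|H| + a) * (2 + 4 * a / c).

Lemma chord_gradient p : U p -> `|p - m| <= g -> `|gradient f p| <= C * g.
Proof.
move=> Up pm.
have := @f_aq xbar (p - xbar) Uxbar; rewrite subrKC => /(_ Up) [_ + _].
rewrite crit subr0 => h.
have pd : `|p - xbar| <= (2 + 4 * a / c) * g.
  rewrite -(subrKA m); apply: le_trans (ler_normD _ _) _.
  by have := foot_dist; move: pm; rewrite !mulrDl mul1r; lra.
rewrite -[gradient f p](subrK (H *m (p - xbar))).
apply: le_trans (ler_normD _ _) _; apply: le_trans (lerD h (norm_mulmx _ _)) _.
rewrite -mulrDl addrC /C -mulrA; apply: ler_pM => //.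
  by rewrite addr_ge0// mulr_ge0.
by rewrite lerD2l; apply: le_trans ea _; rewrite ler_pdivrMr// ler_peMr ?ler1n// ltW.
Qed.

Let M := chord_bound H a c.

Lemma chord_estimates :
  [/\ [/\ `|endpoint_gradient f v p1| <= M & `|endpoint_gradient f v p2| <= M],
      [/\ `|g / D1| <= M & `|g / D2| <= M],
      [/\ `|g / D1 - 2 / a| <= M * e & `|g / D2 - - (2 / a)| <= M * e] &
      `|endpoint_gradient f v p1 + endpoint_gradient f v p2 - (2 / a) *: (H *m v)| <= M * e].
Proof.
have t01 : `|p1 - m| <= g /\ `|p2 - m| <= g.
  case/andP: t0 => t00 tg.
  rewrite mE /p2 opprD !addrA subrr add0r [p1 + _]addrC addrK normrN -scalerBl !normrZ.
  split; rewrite -[leRHS]mulr1; apply: ler_pM => //; first by rewrite ger0_norm.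
  by rewrite ger0_norm ?subr_ge0// gerBl.
have G1 := chord_gradient Up1 t01.1; have G2 := chord_gradient Up2 t01.2.
have C0 : 0 <= C.
  by rewrite mulr_ge0// ?addr_ge0 ?mulr_ge0 ?divr_ge0 ?mulr_ge0// ?invr_ge0 ltW.
have /andP[d11 d12] : - (e * g) <= D1 - a / 2 * g <= e * g.
  by rewrite -ler_norml chord_slope1.
have /andP[d21 d22] : - (e * g) <= D2 + a / 2 * g <= e * g.
  by rewrite -ler_norml chord_slope2.
have eg : e * g <= a / 8 * g by rewrite ler_pM2r.
have ag : 0 < a / 8 * g by rewrite mulr_gt0// divr_gt0.
have D1p : a / 4 * g <= D1 by lra.
have D2p : a / 4 * g <= - D2 by lra.
have D1p0 : 0 < D1 by lra.
have D2p0 : 0 < - D2 by lra.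
have D20 : D2 != 0 by rewrite -oppr_eq0; exact: lt0r_neq0.
have a0n := lt0r_neq0 a0. have D10 := lt0r_neq0 D1p0.
have k1 : `|g / D1| <= 4 / a.
  rewrite ger0_norm ?(divr_ge0 (ltW g0) (ltW D1p0))// ler_pdivrMr//.
  by rewrite -(@ler_pM2l _ (a / 4)) ?divr_gt0// (le_trans D1p)// mulrA (_ : a / 4 * (4 / a) = 1) ?mul1r//; field.
have k2 : `|g / D2| <= 4 / a.
  rewrite -normrN -mulrN -invrN ger0_norm ?(divr_ge0 (ltW g0) (ltW D2p0))// ler_pdivrMr//.
  by rewrite -(@ler_pM2l _ (a / 4)) ?divr_gt0// (le_trans D2p)// mulrA (_ : a / 4 * (4 / a) = 1) ?mul1r//; field.
have est (y w : R) : `|y| <= e * g -> `|w| <= 4 / a ->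
    `|2 / a * (y / g) * w| <= 8 / a ^+ 2 * e.
  move=> yle wle; have -> : 8 / a ^+ 2 * e = 2 / a * e * (4 / a) by field.
  have a2 : 0 <= 2 / a by rewrite divr_ge0// ltW.
  rewrite normrM; apply: ler_pM => //; rewrite normrM (ger0_norm a2).
  by apply: ler_wpM2l => //; rewrite normrM normfV (gtr0_norm g0) ler_pdivrMr.
have e1 : `|g / D1 - 2 / a| <= 8 / a ^+ 2 * e.
  have -> : g / D1 - 2 / a = 2 / a * (- (D1 - a / 2 * g) / g) * (g / D1).
    by field; rewrite a0n D10 lt0r_neq0.
  by apply: est => //; rewrite normrN; exact: chord_slope1.
have e2 : `|g / D2 - - (2 / a)| <= 8 / a ^+ 2 * e.
  have -> : g / D2 - - (2 / a) = 2 / a * ((D2 + a / 2 * g) / g) * (g / D2).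
    by field; rewrite a0n D20 lt0r_neq0.
  by apply: est => //; exact: chord_slope2.
have tauE p : endpoint_gradient f v p = - (g / dot (gradient f p) v) *: (g^-1 *: gradient f p).
  rewrite /endpoint_gradient scalerA mulNr mulrAC divff ?lt0r_neq0// mul1r //.
have gam p : `|gradient f p| <= C * g -> `|g^-1 *: gradient f p| <= C.
  by move=> hp; rewrite normrZ normfV (gtr0_norm g0) mulrC ler_pdivrMr.
have ta p k : k = g / dot (gradient f p) v -> `|k| <= 4 / a -> `|gradient f p| <= C * g ->
    `|endpoint_gradient f v p| <= 4 * C / a.
  move=> kE kk hp; rewrite tauE -kE normrZ normrN mulrAC.
  by apply: ler_pM => //; exact: gam.
have parts : [/\ 0 <= `|H|, 0 <= 4 * C / a, 0 <= 4 / a, 0 <= 8 / a ^+ 2 & 0 <= 16 * C / a ^+ 2 + 2 / a].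
  have ai : 0 <= a^-1 by rewrite invr_ge0 ltW.
  have C4 : 0 <= 4 * C by exact: mulr_ge0.
  have C16 : 0 <= 16 * C by exact: mulr_ge0.
  split => //; rewrite -?exprVn; [exact: mulr_ge0|exact: mulr_ge0| |].
    by apply: mulr_ge0 => //; exact: exprn_ge0.
  apply: addr_ge0; last exact: mulr_ge0.
  by apply: mulr_ge0 => //; exact: exprn_ge0.
have [q1 q2 q3 q4 q5] := parts.
have ME : M = 1 + `|H| + 4 * C / a + 4 / a + 8 / a ^+ 2 + (16 * C / a ^+ 2 + 2 / a) by [].
have M1 : 4 * C / a <= M by rewrite ME; lra.
have M2 : 4 / a <= M by rewrite ME; lra.
have M3 : 8 / a ^+ 2 <= M by rewrite ME; lra.
have M4 : 16 * C / a ^+ 2 + 2 / a <= M by rewrite ME; lra.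
split.
- split; apply: le_trans M1; [apply: (ta _ (g / D1)) => //|apply: (ta _ (g / D2)) => //].
- by split; apply: le_trans M2.
- by split; [apply: le_trans e1 _|apply: le_trans e2 _]; apply: ler_wpM2r.
apply: le_trans (ler_wpM2r e0 M4).
have [_ h _] := f_aq Up1 Up2; rewrite -/p2 in h.
rewrite !tauE -/D1 -/D2.
set u1 := g^-1 *: gradient f p1; set u2 := g^-1 *: gradient f p2.
have hu : `|u2 - u1 - H *m v| <= e.
  have -> : u2 - u1 - H *m v = g^-1 *: (gradient f p2 - gradient f p1 - H *m (g *: v)).
    by rewrite -scalemxAr !scalerBr scalerA mulVf ?lt0r_neq0// scale1r.
  rewrite normrZ normfV (gtr0_norm g0) mulrC ler_pdivrMr//; apply: le_trans h _.
  apply: ler_wpM2l => //; rewrite normrZ (gtr0_norm g0) -[leRHS]mulr1.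
  by apply: ler_wpM2l => //; exact: ltW.
have -> : - (g / D1) *: u1 + - (g / D2) *: u2 - (2 / a) *: (H *m v) =
   - (g / D1 - 2 / a) *: u1 - (g / D2 - - (2 / a)) *: u2 + (2 / a) *: (u2 - u1 - H *m v).
  apply/colP => i; rewrite !mxE; ring.
have := (gam _ G1, gam _ G2); rewrite -/u1 -/u2.
move: u1 u2 hu => u1 u2 hu [gu1 gu2].
have a2 : 0 <= 2 / a by rewrite divr_ge0// ltW.
apply: le_trans (ler_normD _ _) _; apply: (le_trans (lerD (ler_normB _ _) (lexx _))).
rewrite [`|(2 / a) *: _|]normrZ (ger0_norm a2) !normrZ normrN.
have -> : (16 * C / a ^+ 2 + 2 / a) * e = 8 / a ^+ 2 * e * C + 8 / a ^+ 2 * e * C + 2 / a * e.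
  by field.
apply: lerD; last exact: ler_wpM2l.
by apply: lerD; apply: ler_pM.
Qed.

End Chord.

(** * Endpoints of the chords *)

(** The parameters t of the points x + t v of the line through x parallel to v
    that lie in U and where f is at least l. *)
Definition slice (R : realType) (n : nat) (f : 'cV[R]_n -> R) (U : set 'cV[R]_n)
    (l : R) (v x : 'cV[R]_n) : set R :=
  [set t | U (x + t *: v) /\ l <= f (x + t *: v)].

Lemma slice_opp (R : realType) (n : nat) (f : 'cV[R]_n -> R) (U : set 'cV[R]_n)
    (l : R) (v x : 'cV[R]_n) : slice f U l (- v) x = -%R @` slice f U l v x.
Proof.
apply/seteqP; split => [t [h1 h2]|_ [t [h1 h2] <-]].
  exists (- t); last by rewrite opprK.
  by rewrite /slice /= scaleNr -scalerN.
by rewrite /slice /= scalerN scaleNr opprK.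
Qed.

Lemma line_superlevelE (R : realType) (n : nat) (f : 'cV[R]_n -> R) (U : set 'cV[R]_n)
    (l : R) (v x : 'cV[R]_n) :
  line_superlevel U f l v x = (fun t => x + t *: v) @` slice f U l v x.
Proof.
apply/seteqP; split => [y [Uy [t lt yE]]|y [t [Ut lt] <-]]; last by split => //; exists t.
by exists t => //; split => //; rewrite yE.
Qed.

Lemma diam_segment (R : realType) (n : nat) (A : set R) (v x : 'cV[R]_n) (t1 t2 : R) :
  enorm v = 1 -> A t1 -> A t2 -> (forall t, A t -> t1 <= t <= t2) ->
  diam ((fun t => x + t *: v) @` A) = t2 - t1.
Proof.
move=> v1 At1 At2 Abd.
have E t t' : enorm (x + t *: v - (x + t' *: v)) = `|t - t'|.
  by rewrite opprD addrACA subrr add0r -scalerBl enormZ v1 mulr1.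
have t12 : t1 <= t2 by have /andP[] := Abd _ At1.
apply/eqP; rewrite eq_le; apply/andP; split.
  apply: ge_sup.
    by exists `|t1 - t1|, (x + t1 *: v, x + t1 *: v) => //=; split; exists t1.
  move=> _ [[_ _] [/= [t At <-] [t' At' <-]] <-]; rewrite E ler_norml.
  by have /andP[??] := Abd _ At; have /andP[??] := Abd _ At'; apply/andP; split; lra.
apply: ub_le_sup; last first.
  exists (x + t2 *: v, x + t1 *: v); first by split; [exists t2|exists t1].
  by rewrite /= E ger0_norm// subr_ge0.
exists (t2 - t1) => _ [[_ _] [/= [t At <-] [t' At' <-]] <-]; rewrite E ler_norml.
by have /andP[??] := Abd _ At; have /andP[??] := Abd _ At'; apply/andP; split; lra.
Qed.

Section Endpoints.
Variables (R : realType) (n : nat).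
Notation V := 'cV[R]_n.
Variables (f : V -> R) (xbar : V) (H : 'M[R]_n) (a c e l s : R) (U U' : set V).
Hypotheses (f_aq : almost_quadratic f H e U') (U'xbar : U' xbar).
Hypothesis f_diff : forall x, U' x -> differentiable f x.
Hypothesis crit : gradient f xbar = 0.
Hypotheses (a0 : 0 < a) (c0 : 0 < c) (e0 : 0 <= e).
Hypotheses (ea : e <= a / 8) (ec : e <= c / 4) (lf : l <= f xbar).
Hypothesis openU : open U.

(** On the line through x in U parallel to v, the points x + t v of U' where f is
    at least l satisfy |t| < s, while U' contains all the points with |t| <= s,
    one of which is the foot of the H-orthogonal projection of xbar. *)
Definition localized (v : V) : Prop :=
  [/\ forall x t, U x -> U' (x + t *: v) -> l <= f (x + t *: v) -> `|t| < s,
      forall x t, U x -> `|t| <= s -> U' (x + t *: v) &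
      forall x, U x -> exists2 t, `|t| <= s & dot v (H *m (x + t *: v - xbar)) = 0].

Lemma localizedN v : localized v -> localized (- v).
Proof.
case=> h1 h2 h3; split.
- by move=> x t Ux; rewrite scalerN -scaleNr -(normrN t); exact: h1.
- by move=> x t Ux; rewrite scalerN -scaleNr -(normrN t); exact: h2.
- move=> x Ux; have [t ts tE] := h3 x Ux; exists (- t); first by rewrite normrN.
  by rewrite scalerN scaleNr opprK dotNl tE oppr0.
Qed.

Section Direction.
Variable v : V.
Hypotheses (vHv : dot v (H *m v) = - a) (v1 : `|v| <= 1).
Hypothesis coercive : forall q, dot v (H *m q) = 0 -> c * `|q| ^+ 2 <= dot q (H *m q).
Hypothesis loc : localized v.

Local Notation S := (slice f U' l v).

Lemma slice_bound x t : U x -> S x t -> `|t| < s.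
Proof. by case: loc => h _ _ Ux [Ut lt]; apply: (h x). Qed.

Lemma slice_foot x : U x -> exists t, [/\ S x t, `|t| <= s,
  dot v (H *m (x + t *: v - xbar)) = 0 & l < f xbar -> l < f (x + t *: v)].
Proof.
case: loc => _ h2 h3 Ux; have [t ts tE] := h3 x Ux; exists t.
have Ut : U' (x + t *: v) by exact: h2.
have h := foot_value f_aq U'xbar crit coercive ec Ut tE.
have h' : 0 <= c / 4 * `|x + t *: v - xbar| ^+ 2.
  by rewrite mulr_ge0 ?sqr_ge0// divr_ge0// ltW.
have h1 : f xbar <= f (x + t *: v) by apply: le_trans h; rewrite lerDl.
split => //; first by split => //; exact: le_trans h1.
by move=> ?; exact: lt_le_trans h1.
Qed.

(** f is strongly concave along v. *)
Lemma slice_concave x t t' : U x -> `|t| <= s -> `|t'| <= s ->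
  f (x + t' *: v) <= f (x + t *: v) + (t' - t) * dot (gradient f (x + t *: v)) v
    - a / 4 * (t' - t) ^+ 2.
Proof.
case: loc => _ h2 _ Ux ts t's.
have E : x + t' *: v = x + t *: v + (t' - t) *: v.
  by rewrite -addrA -scalerDl subrKC.
have Ut := h2 _ _ Ux ts; have Ut' := h2 _ _ Ux t's; rewrite E in Ut' *.
have := slice_expansion f_aq e0 vHv v1 Ut Ut'.
rewrite ler_norml => /andP[_].
have : e * (t' - t) ^+ 2 <= a / 8 * (t' - t) ^+ 2 by apply: ler_wpM2r => //; exact: sqr_ge0.
have : 0 <= a * (t' - t) ^+ 2 by rewrite mulr_ge0 ?sqr_ge0// ltW.
rewrite [a / 8 * _]mulrAC [a / 4 * _]mulrAC -[2^-1 * a * _]mulrA.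
set X := a * _; set Y := (t' - t) * _; set Z := e * _.
by move=> *; lra.
Qed.

Lemma slice_interval x t1 t2 t : U x -> S x t1 -> S x t2 -> t1 < t < t2 ->
  S x t /\ l < f (x + t *: v).
Proof.
move=> Ux S1 S2 /andP[t1t tt2].
have b1 := slice_bound Ux S1; have b2 := slice_bound Ux S2.
have b : `|t| <= s.
  by move: b1 b2; rewrite !ltr_norml ler_norml => /andP[??] /andP[??]; apply/andP; split; lra.
have c1 := slice_concave Ux b (ltW b1); have c2 := slice_concave Ux b (ltW b2).
have [_ l1] := S1; have [_ l2] := S2.
have lt : l < f (x + t *: v).
  set D := dot _ _ in c1 c2.
  have [D0|D0] := leP 0 D.
    have : 0 <= (t - t1) * D by rewrite mulr_ge0// subr_ge0 ltW.
    have : 0 < a / 4 * (t1 - t) ^+ 2.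
      by rewrite mulr_gt0 ?divr_gt0// exprn_even_gt0//= subr_eq0 lt_eqF.
    rewrite -[t1 - t]opprB mulNr sqrrN in c1 *.
    set X := (t - t1) * D in c1 *; set Y := a / 4 * _ in c1 *.
    by move=> *; lra.
  have : (t2 - t) * D <= 0 by rewrite mulr_ge0_le0// ?subr_ge0 ltW.
  have : 0 < a / 4 * (t2 - t) ^+ 2.
    by rewrite mulr_gt0 ?divr_gt0// exprn_even_gt0//= subr_eq0 gt_eqF.
  set X := (t2 - t) * D in c2 *; set Y := a / 4 * _ in c2 *.
  by move=> *; lra.
split => //; split; last exact: ltW.
by case: loc => _ h2 _; apply: h2.
Qed.

Lemma slice_has_sup x : U x -> has_sup (S x).
Proof.
move=> Ux; split; first by have [t [St _ _ _]] := slice_foot Ux; exists t.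
by exists s => t /(slice_bound Ux); rewrite ltr_norml => /andP[_ /ltW].
Qed.

Lemma slice_continuous x t : U x -> `|t| <= s ->
  {for t, continuous (fun t : R => f (x + t *: v))}.
Proof.
case: loc => _ h2 _ Ux ts.
have df := f_diff (h2 _ _ Ux ts).
have [d _] := is_derive_line df.
by apply: differentiable_continuous; exact/derivable1_diffP.
Qed.

Lemma sup_slice_norm x : U x -> `|sup (S x)| <= s.
Proof.
move=> Ux; have [t [St _ _ _]] := slice_foot Ux.
have tsup : t <= sup (S x) by apply: sup_upper_bound => //; exact: slice_has_sup.
have sups : sup (S x) <= s.
  apply: ge_sup; first by exists t.
  by move=> u /(slice_bound Ux); rewrite ltr_norml => /andP[_ /ltW].
have := slice_bound Ux St; rewrite ltr_norml ler_norml sups andbT => /andP[? _]; lra.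
Qed.

Lemma sup_slice_value x : U x -> S x (sup (S x)) /\ f (x + sup (S x) *: v) = l.
Proof.
move=> Ux; set T := sup (S x).
have Ts : `|T| <= s := sup_slice_norm Ux.
have UT : U' (x + T *: v) by case: loc => _ h2 _; exact: h2.
have cT := slice_continuous Ux Ts.
have lT : l <= f (x + T *: v).
  rewrite leNgt; apply/negP => ltl.
  have /nbhs_normP[d /= d0 dP] : \forall t \near T, f (x + t *: v) < l.
    exact: continuous_near_lt cT ltl.
  have [t St tT] := sup_adherent d0 (slice_has_sup Ux).
  have tleT : t <= T by apply: sup_upper_bound => //; exact: slice_has_sup.
  have /= := dP t; rewrite ger0_norm ?subr_ge0// => h.
  have : T - t < d by rewrite -/T in tT; lra.
  by move=> /h; case: St => _; rewrite leNgt => /negP.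
have ST : S x T by [].
split => //; apply/eqP; rewrite eq_le lT andbT leNgt; apply/negP => lltf.
have TS := slice_bound Ux ST.
have /nbhs_normP[d /= d0 dP] : \forall t \near T, l < f (x + t *: v).
  exact: continuous_near_gt cT lltf.
(* Beyond T, the points T + h are still in the slice when f exceeds l at T. *)
pose h := Num.min (d / 2) ((s - T) / 2).
have Tlts : T < s by move: TS; rewrite ltr_norml => /andP[].
have h0 : 0 < h by rewrite lt_min !divr_gt0// subr_gt0.
have hd : h <= d / 2 by rewrite /h ge_min lexx.
have hs : h <= (s - T) / 2 by rewrite /h ge_min lexx orbT.
have SX : S x (T + h).
  split; first by case: loc => _ h2 _; apply: h2 => //; move: TS;
    rewrite ltr_norml ler_norml => /andP[??]; apply/andP; split; lra.
  by apply/ltW/dP => /=; rewrite opprD addrA subrr sub0r normrN gtr0_norm//; lra.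
have : T + h <= T by apply: sup_upper_bound => //; exact: slice_has_sup.
by rewrite gerDl leNgt h0.
Qed.

(** The upper endpoint depends continuously on the line as long as the slice is
    not reduced to a point. *)
Lemma sup_slice_continuous x t1 : U x -> S x t1 -> t1 < sup (S x) ->
  {for x, continuous (fun y => sup (S y))}.
Proof.
move=> Ux St1 t1T; set T := sup (S x) in t1T *.
have [ST fT] := sup_slice_value Ux.
have := slice_bound Ux ST; rewrite -/T ltr_norml => /andP[Tl Tr].
have := slice_bound Ux St1; rewrite ltr_norml => /andP[t1l t1r].
apply: continuous_atP => eps eps0.
pose h := Num.min eps (Num.min ((T - t1) / 2) ((s - T) / 2)).
have h0 : 0 < h by rewrite !lt_min eps0 !divr_gt0// subr_gt0.
have he : h <= eps by rewrite /h ge_min lexx.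
have h1 : h <= (T - t1) / 2 by rewrite /h !ge_min lexx orbT.
have h2 : h <= (s - T) / 2 by rewrite /h !ge_min lexx !orbT.
have cf (t : R) : `|t| <= s -> {for x, continuous (fun y : V => f (y + t *: v))}.
  move=> ts; have df : differentiable f (x + t *: v).
    by apply: f_diff; case: loc => _ k2 _; exact: k2.
  apply: (@continuous_comp _ _ _ (fun y : V => y + t *: v) f).
    by apply: differentiable_continuous; exact: differentiableD.
  exact: differentiable_continuous.
have bm : `|T - h| <= s by rewrite ler_norml; apply/andP; split; lra.
have bp : `|T + h| <= s by rewrite ler_norml; apply/andP; split; lra.
(* f is above l at T - h and below l at T + h on the line of x, hence on the
   nearby lines, whose upper endpoints are then between T - h and T + h. *)
have lm : l < f (x + (T - h) *: v).
  by have [|//] := @slice_interval x t1 T (T - h) Ux St1 ST; apply/andP; split; lra.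
have lp : f (x + (T + h) *: v) < l.
  rewrite ltNge; apply/negP => lp.
  have : S x (T + h) by split => //; case: loc => _ k2 _; exact: k2.
  move/(sup_upper_bound (slice_has_sup Ux)); rewrite -/T; lra.
near=> y.
have Uy : U y by near: y; exact: open_nbhs_nbhs.
have lmy : l < f (y + (T - h) *: v).
  by near: y; exact: continuous_near_gt (cf _ bm) lm.
have lpy : f (y + (T + h) *: v) < l.
  by near: y; exact: continuous_near_lt (cf _ bp) lp.
have Sm : S y (T - h) by split; [case: loc => _ k2 _; exact: k2|exact: ltW].
have m1 := sup_upper_bound (slice_has_sup Uy) Sm.
have [STy _] := sup_slice_value Uy.
have m2 : sup (S y) <= T + h.
  rewrite leNgt; apply/negP => lt.
  have [|_] := @slice_interval y (T - h) (sup (S y)) (T + h) Uy Sm STy.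
    by apply/andP; split => //; lra.
  by rewrite ltNge (ltW lpy).
rewrite -/T; move: (sup (S y)) m1 m2 => Ty m1 m2.
by rewrite ler_norml; apply/andP; split; lra.
Unshelve. all: by end_near. Qed.

End Direction.

End Endpoints.

(** * Implicit differentiation of the endpoints *)

Section LocalEquality.
Variables (R : realType) (V W : normedModType R).

Lemma near_eq_diff (F G : V -> W) (x : V) : (\forall y \near x, F y = G y) ->
  differentiable F x -> differentiable G x /\ 'd G x = 'd F x :> (V -> W).
Proof.
move=> FG dF.
have [dG dGE] : is_diff x G ('d F x).
  apply: expand_differentiable; first exact: diff_continuous.
  move=> e e0.
  have ex := differentiable_expand dF e0.
  have FG0 : \forall h \near (0 : V), F (x + h) = G (x + h).
    move: FG => /nbhs_normP[r /= r0 FG]; apply/nbhs_normP; exists r => // h /=.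
    by rewrite sub0r normrN => hr; apply: FG => /=; rewrite opprD addNKr normrN.
  near=> h.
  have <- : F (x + h) = G (x + h) by near: h.
  have <- : F x = G x by exact: nbhs_singleton FG.
  by near: h.
by [].
Unshelve. all: by end_near. Qed.

End LocalEquality.

Lemma is_diff_slide (R : realType) (V : normedModType R) (T : V -> R) (v x : V) :
  differentiable T x ->
  is_diff x (fun y : V => y + T y *: v) (fun h => h + 'd T x h *: v).
Proof.
move=> dT.
have dTv : is_diff x (fun y : V => T y *: v) (fun h => 'd T x h *: v).
  by split; [exact: differentiableZl|rewrite diffZl].
exact: is_diffD (is_diff_id x) dTv.
Qed.

Section SecondOrderCalculus.
Variables (R : realType) (n : nat).
Notation V := 'cV[R]_n.
Implicit Types (F G f T : V -> R) (x v : V).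

Lemma near_eq_gradient F G x : (\forall y \near x, F y = G y) ->
  \forall y \near x, gradient F y = gradient G y.
Proof.
move=> FG.
have FG2 : \forall y \near x, \forall z \near y, F z = G z by exact: near_join.
move: FG2; apply: filterS => y yFG.
by apply/colP => i; rewrite !mxE; exact: near_eq_derive.
Qed.

Lemma twice_differentiable_near_eq F G x : (\forall y \near x, F y = G y) ->
  twice_differentiable F x -> twice_differentiable G x /\ hessian G x = hessian F x.
Proof.
move=> FG [dF dgF].
have gE := near_eq_gradient FG.
split; last first.
  apply/matrixP => i j; rewrite [LHS]mxE [RHS]mxE; apply: near_eq_derive.
  by move: gE; apply: filterS => y ->.
split; last by have [] := near_eq_diff gE dgF.
have FG2 : \forall y \near x, \forall z \near y, F z = G z by exact: near_join.
near=> y.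
have yFG : \forall z \near y, F z = G z by near: y.
have dy : differentiable F y by near: y.
by have [] := near_eq_diff yFG dy.
Unshelve. all: by end_near. Qed.

Lemma derive_entry (F : V -> V) x u i : differentiable F x ->
  'D_u (fun y => F y i 0) x = ('d F x u) i 0.
Proof.
move=> dF; rewrite -deriveE// derive_mx ?mxE//; exact: diff_derivable.
Qed.

Lemma hessianE f x i j :
  'D_(delta_mx j 0) (fun y => gradient f y i 0) x = hessian f x i j.
Proof. by rewrite mxE. Qed.

Lemma gradientE f x i : 'D_(delta_mx i 0) f x = gradient f x i 0.
Proof. by rewrite mxE. Qed.

Lemma twice_differentiableB F G x :
  twice_differentiable F x -> twice_differentiable G x ->
  [/\ twice_differentiable (fun y => F y - G y) x,
      gradient (fun y => F y - G y) x = gradient F x - gradient G x &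
      hessian (fun y => F y - G y) x = hessian F x - hessian G x].
Proof.
move=> [dF dgF] [dG dgG].
have gE : \forall y \near x, gradient F y - gradient G y = gradient (fun y => F y - G y) y.
  near=> y.
  have dFy : differentiable F y by near: y.
  have dGy : differentiable G y by near: y.
  by apply/colP => i; rewrite !mxE deriveB//; exact: diff_derivable.
have dB : differentiable (fun y => gradient F y - gradient G y) x by exact: differentiableB.
split; first split.
- near=> y; apply: differentiableB; by near: y.
- by have [] := near_eq_diff gE dB.
- by rewrite (nbhs_singleton gE).
- apply/matrixP => i j; 
  have -> : (hessian F x - hessian G x) i j =
      'D_(delta_mx j 0) (fun y => gradient F y i 0) x -
      'D_(delta_mx j 0) (fun y => gradient G y i 0) x by rewrite !mxE.
  rewrite mxE.
  have -> : 'D_(delta_mx j 0) (fun y => gradient (fun y => F y - G y) y i 0) x =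
     'D_(delta_mx j 0) (fun y => gradient F y i 0 - gradient G y i 0) x.
    apply: near_eq_derive; move: gE; apply: filterS => y <-.
    by rewrite !mxE.
  by rewrite deriveB//; apply: diff_derivable; exact: differentiable_entry.
Unshelve. all: by end_near. Qed.

Lemma twice_differentiable_sqr F x : twice_differentiable F x ->
  twice_differentiable (fun y => F y ^+ 2) x /\
  hessian (fun y => F y ^+ 2) x = square_hessian (F x) (gradient F x) (hessian F x).
Proof.
move=> [dF dgF].
have dFx := nbhs_singleton dF.
have sq : (fun y => F y ^+ 2) = F * F by apply/funext => y; rewrite expr2.
have gE : \forall y \near x, (2 * F y) *: gradient F y = gradient (fun y => F y ^+ 2) y.
  near=> y.
  have dFy : differentiable F y by near: y.
  apply/colP => i; rewrite !mxE sq deriveM; do ?exact: diff_derivable.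
  by rewrite /GRing.scale/=; ring.
have d2F : differentiable (fun y => 2 * F y) x.
  by apply: (@differentiableZ _ _ _ F 2).
have dE : differentiable (fun y => (2 * F y) *: gradient F y) x.
  apply: differentiable_cV => i.
  have -> : (fun y => ((2 * F y) *: gradient F y) i 0) = (fun y => 2 * F y) * (fun y => gradient F y i 0).
    by apply/funext => y; rewrite mxE.
  by apply: differentiableM => //; exact: differentiable_entry.
split; first split.
- near=> y; rewrite sq; apply: differentiableM; by near: y.
- by have [] := near_eq_diff gE dE.
apply/matrixP => i j; rewrite mxE.
have -> : 'D_(delta_mx j 0) (fun y => gradient (fun y => F y ^+ 2) y i 0) x =
   'D_(delta_mx j 0) ((2 *: F) * (fun y => gradient F y i 0)) x.
  apply: near_eq_derive; move: gE; apply: filterS => y <-.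
  by rewrite mxE.
rewrite deriveM; last 2 first.
- by apply: diff_derivable; exact: differentiableZ.
- by apply: diff_derivable; exact: differentiable_entry.
rewrite deriveZ; last exact: diff_derivable.
rewrite hessianE// gradientE /square_hessian [RHS]mxE [in RHS]mxE outer_entry.
have -> : ((2 * F x) *: hessian F x) i j = 2 * F x * hessian F x i j by rewrite mxE.
have -> : (2 *: F) x = 2 * F x by [].
by rewrite /GRing.scale/=; ring.
Unshelve. all: by end_near. Qed.

(** The implicit function theorem for f (x + T(x) v) = constant, the continuous
    solution T being given. *)
Lemma endpoint_differentiable f T v x : {for x, continuous T} ->
  differentiable f (x + T x *: v) ->
  dot (gradient f (x + T x *: v)) v != 0 ->
  (\forall y \near x, f (y + T y *: v) = f (x + T x *: v)) ->
  differentiable T x /\ gradient T x = endpoint_gradient f v (x + T x *: v).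
Proof.
set p := x + _; move=> cT df; set G := gradient f p; set D := dot G v => D0 fT.
apply: expand_gradient => e e0.
have Dn0 : 0 < `|D| by rewrite normr_gt0.
(* K is a Lipschitz constant of T at x, obtained first; eta is the error allowed
   in the expansion of f, small enough to absorb the increment of T. *)
pose K := 2 / `|D| * (n%:R * `|G| + 1).
have K0 : 0 <= K by rewrite mulr_ge0 ?divr_ge0// addr_ge0// mulr_ge0.
have Kv : 0 < 1 + K * `|v| by rewrite ltr_wpDr// mulr_ge0.
have v10 : 0 < 1 + `|v| by rewrite ltr_wpDr.
pose eta := Num.min 1 (Num.min (`|D| / 2 / (1 + `|v|)) (e * `|D| / (1 + K * `|v|))).
have eta0 : 0 < eta by rewrite !lt_min ltr01 !divr_gt0// mulr_gt0.
have eta1 : eta <= 1 by rewrite /eta ge_min lexx.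
have eta2 : eta * (1 + `|v|) <= `|D| / 2.
  by rewrite -ler_pdivlMr// /eta !ge_min lexx orbT.
have eta3 : eta * (1 + K * `|v|) <= e * `|D|.
  by rewrite -ler_pdivlMr// /eta !ge_min lexx !orbT.
have := differentiable_expand df eta0.
move=> /nbhs_normP[r /= r0 ex].
have fT0 : \forall h \near (0 : V), f (x + h + T (x + h) *: v) = f p.
  move: fT => /nbhs_normP[d /= d0 fT]; apply/nbhs_normP; exists d => // h /=.
  by rewrite sub0r normrN => hr; apply: fT => /=; rewrite opprD addNKr normrN.
pose q := r / 2 / (1 + `|v|).
have q0 : 0 < q by rewrite !divr_gt0.
have cT0 : \forall h \near (0 : V), `|T x - T (x + h)| <= q.
  have := continuous_at_dist cT q0.
  move=> /nbhs_normP[d /= d0 cTd]; apply/nbhs_normP; exists d => // h /=.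
  by rewrite sub0r normrN => hr; apply: cTd => /=; rewrite opprD addNKr normrN.
have r4 : 0 < r / 4 by rewrite divr_gt0.
have sm := @near0_norm_le R V _ r4.
near=> h.
have h1 : `|h| <= r / 4 by near: h.
have h2 : `|T x - T (x + h)| <= q by near: h.
have h3 : f (x + h + T (x + h) *: v) = f p by near: h.
set sg := T (x + h) - T x.
have h2' : `|sg| <= q by rewrite distrC in h2.
have kr : `|h + sg *: v| < r.
  apply: le_lt_trans (ler_normD _ _) _; rewrite normrZ.
  have h4 : `|sg| * `|v| <= r / 2.
    apply: (@le_trans _ _ (q * (1 + `|v|))).
      by apply: ler_pM => //; rewrite lerDr.
    by rewrite /q divfK// gt_eqF.
  by apply: le_lt_trans (lerD h1 h4) _; move: r0; clear; lra.
have := ex (h + sg *: v); rewrite /= sub0r normrN => /(_ kr).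
have -> : p + (h + sg *: v) = x + h + T (x + h) *: v.
  by rewrite /p /sg scalerBl addrACA subrKC.
rewrite h3 subrr sub0r normrN diff_gradient// -/G dotDr dotZr -/D => key.
have kn : `|h + sg *: v| <= `|h| + `|sg| * `|v|.
  by apply: le_trans (ler_normD _ _) _; rewrite normrZ.
have key2 : `|dot G h + sg * D| <= eta * (`|h| + `|sg| * `|v|).
  by apply: le_trans key _; apply: ler_wpM2l => //; exact: ltW.
have sgK : `|sg| <= K * `|h|.
  have a1 : `|sg| * `|D| <= n%:R * `|G| * `|h| + eta * (`|h| + `|sg| * `|v|).
    rewrite -normrM -(addKr (dot G h) (sg * D)).
    apply: le_trans (ler_normD _ _) _; rewrite normrN.
    by apply: lerD; [exact: norm_dot|].
  have a2 : eta * (`|sg| * `|v|) <= `|D| / 2 * `|sg|.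
    rewrite mulrCA mulrC; apply: ler_wpM2r => //; apply: le_trans eta2.
    by apply: ler_wpM2l; [exact: ltW|rewrite lerDr].
  have a3 : eta * `|h| <= `|h| by rewrite ler_piMl.
  have a4 : `|D| / 2 * `|sg| <= (n%:R * `|G| + 1) * `|h|.
    have lin (X1 X2 X3 X4 X5 : R) : X1 <= X2 + (X3 + X4) -> X4 <= X1 / 2 ->
      X3 <= X5 -> X1 / 2 <= X2 + X5 by move=> *; lra.
    have E : `|D| / 2 * `|sg| = `|sg| * `|D| / 2 by ring.
    rewrite E in a2 *; rewrite mulrDl mul1r.
    by apply: lin a2 a3; rewrite -mulrDr.
  rewrite -(@ler_pM2l _ (`|D| / 2)) ?divr_gt0//; apply: le_trans a4 _.
  by rewrite le_eqVlt /K; apply/orP; left; apply/eqP; field; exact: lt0r_neq0.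
have -> : T (x + h) - T x - dot (endpoint_gradient f v p) h = D^-1 * (dot G h + sg * D).
  rewrite -/sg /endpoint_gradient -/G -/D dotZl; field; exact: D0.
rewrite normrM normfV mulrC ler_pdivrMr//; apply: le_trans key2 _.
apply: (@le_trans _ _ (eta * (1 + K * `|v|) * `|h|)).
  rewrite -mulrA; apply: ler_wpM2l; first exact: ltW.
  by rewrite mulrDl mul1r lerD2l mulrAC; apply: ler_wpM2r.
by rewrite [leRHS]mulrAC; apply: ler_wpM2r.
Unshelve. all: by end_near. Qed.

(** Differentiating once more the formula for the gradient of T. *)
Lemma endpoint_twice_differentiable f T v x :
  differentiable (gradient f) (x + T x *: v) ->
  dot (gradient f (x + T x *: v)) v != 0 ->
  (\forall y \near x, differentiable T y /\
     gradient T y = endpoint_gradient f v (y + T y *: v)) ->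
  twice_differentiable T x /\
  hessian T x = endpoint_hessian (dot (gradient f (x + T x *: v)) v)
    (hessian f (x + T x *: v)) (gradient T x) v.
Proof.
set p := x + _; move=> dg D0 Tn.
have [dT gT] := nbhs_singleton Tn; rewrite -/p in gT.
pose N := gradient f \o (fun y : V => y + T y *: v).
have dN : is_diff x N ('d (gradient f) p \o (fun h => h + 'd T x h *: v)).
  exact: is_diff_comp (is_diff_slide v dT) (differentiableP dg).
have dNE u : 'd N x u = hessian f p *m (u + dot (gradient T x) u *: v).
  by rewrite diff_val /= diff_gradient// diff_hessian.
pose D y := dot (N y) v.
have DE : D = \sum_(i < n) (v i 0 *: (fun y => N y i 0)).
  by apply/funext => y; rewrite /D dotC dotE fct_sumE.
have dD : differentiable D x.
  rewrite DE; apply: differentiable_sum => i; apply: differentiableZ.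
  exact: differentiable_entry.
have dDE u : 'D_u D x = dot ('d N x u) v.
  rewrite DE derive_sum; last first.
    by move=> i; apply: derivableZ; apply: diff_derivable; exact: differentiable_entry.
  rewrite dotC dotE; apply: eq_bigr => i _; rewrite deriveZ ?derive_entry//.
  by apply: diff_derivable; exact: differentiable_entry.
have Dx0 : D x != 0 by [].
have gE : \forall y \near x, - (D y)^-1 *: N y = gradient T y.
  by move: Tn; apply: filterS => y [_ ->].
have dV : differentiable (fun y => - (D y)^-1) x.
  by apply: differentiableN; exact: differentiableV.
have dQ : differentiable (fun y => - (D y)^-1 *: N y) x.
  apply: differentiable_cV => i.
  have -> : (fun y => (- (D y)^-1 *: N y) i 0) = (fun y => - (D y)^-1) * (fun y => N y i 0).
    by apply/funext => y; rewrite mxE.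
  by apply: differentiableM => //; exact: differentiable_entry.
split; first split.
- by move: Tn; apply: filterS => y [].
- by have [] := near_eq_diff gE dQ.
apply/matrixP => i j; rewrite mxE.
have -> : 'D_(delta_mx j 0) (fun y => gradient T y i 0) x =
    'D_(delta_mx j 0) ((- (fun y => (D y)^-1)) * (fun y => N y i 0)) x.
  by apply: near_eq_derive; move: gE; apply: filterS => y <-; rewrite mxE.
have dVi : derivable (fun y => (D y)^-1) x (delta_mx j 0).
  by apply: derivableV => //; exact: diff_derivable.
rewrite deriveM; last 2 first.
- exact: derivableN.
- by apply: diff_derivable; exact: differentiable_entry.
rewrite deriveN// deriveV//; last exact: diff_derivable.
rewrite derive_entry// dDE dNE.
rewrite /endpoint_hessian [RHS]mxE conj_entry dot_delta.
set k := delta_mx j 0 + _; set X := hessian f p *m k.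
rewrite dotDl dotZl [dot (delta_mx _ _) X]dotC dot_delta [dot v X]dotC.
have -> : gradient T x i 0 = - (D x)^-1 * N x i 0 by rewrite gT mxE.
rewrite -[dot (gradient f p) v]/(D x) /GRing.scale/= -[(- (fun y => (D y)^-1)) x]/(- (D x)^-1).
by field.
Qed.

End SecondOrderCalculus.

(** * The Hessian of the squared parallel distance *)

Section EndpointInvariance.
Variables (R : realType) (n : nat).
Notation V := 'cV[R]_n.
Implicit Types (tau v u w : V).

Lemma endpoint_gradient_dir (f : V -> R) v p : dot (gradient f p) v != 0 ->
  dot (endpoint_gradient f v p) v = -1.
Proof. by move=> D0; rewrite /endpoint_gradient dotZl mulNr mulVf. Qed.

Lemma endpoint_hessian_dir D (A : 'M[R]_n) tau v : dot tau v = -1 ->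
  endpoint_hessian D A tau v *m v = 0 /\
  forall w, dot v (endpoint_hessian D A tau v *m w) = 0.
Proof.
move=> tv; have E : (1%:M + v *m tau^T) *m v = 0.
  by rewrite shear_mulmx tv scaleN1r subrr.
split; first by rewrite /endpoint_hessian -scalemxAl -!mulmxA E !mulmx0 scaler0.
by move=> w; rewrite /endpoint_hessian -scalemxAl dotZr conj_dot E dot0l mulr0.
Qed.

Lemma square_hessian_dir g p (B : 'M[R]_n) v : dot p v = 0 -> B *m v = 0 ->
  (forall w, dot v (B *m w) = 0) ->
  forall u b, dot (u + b *: v) (square_hessian g p B *m (u + b *: v)) =
    dot u (square_hessian g p B *m u).
Proof.
move=> pv Bv vB u b.
have E1 : square_hessian g p B *m v = 0.
  by rewrite /square_hessian mulmxDl -!scalemxAl outer_mulmx pv Bv scale0r !scaler0 addr0.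
have E2 w : dot v (square_hessian g p B *m w) = 0.
  rewrite /square_hessian mulmxDl -!scalemxAl outer_mulmx dotDr !dotZr vB.
  by rewrite [dot v p]dotC pv !mulr0 addr0.
by rewrite mulmxDr -scalemxAr E1 scaler0 addr0 dotDl dotZl E2 mulr0 addr0.
Qed.

(** The Hessian of the squared chord length is invariant under translations along
    v. *)
Lemma chord_hessian_dir g D1 D2 (A1 A2 : 'M[R]_n) tau1 tau2 v :
  dot tau1 v = -1 -> dot tau2 v = -1 ->
  let h := square_hessian g (tau2 - tau1)
    (endpoint_hessian D2 A2 tau2 v - endpoint_hessian D1 A1 tau1 v) in
  forall u b, dot (u + b *: v) (h *m (u + b *: v)) = dot u (h *m u).
Proof.
move=> k1 k2 /=; apply: square_hessian_dir.
- by rewrite dotBl k1 k2 subrr.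
- have [z1 _] := endpoint_hessian_dir D1 A1 k1.
  by have [z2 _] := endpoint_hessian_dir D2 A2 k2; rewrite mulmxBl z1 z2 subrr.
- move=> w; have [_ z1] := endpoint_hessian_dir D1 A1 k1.
  by have [_ z2] := endpoint_hessian_dir D2 A2 k2; rewrite mulmxBl dotBr z1 z2 subrr.
Qed.

End EndpointInvariance.

Section DistanceHessian.
Variables (R : realType) (n : nat).
Notation V := 'cV[R]_n.
Variables (f : V -> R) (xbar : V) (H : 'M[R]_n) (a c e l s : R) (U U' : set V).
Hypotheses (f_aq : almost_quadratic f H e U') (U'xbar : U' xbar).
Hypothesis f_diff2 : forall x, U' x -> twice_differentiable f x.
Hypothesis crit : gradient f xbar = 0.
Hypotheses (a0 : 0 < a) (c0 : 0 < c) (e0 : 0 <= e) (e1 : e <= 1).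
Hypotheses (ea : e <= a / 8) (ec : e <= c / 4) (lf : l <= f xbar).
Hypothesis openU : open U.
Variable v : V.
Hypotheses (Hs : H^T = H) (vHv : dot v (H *m v) = - a) (ev1 : enorm v = 1).
Hypothesis coercive : forall q, dot v (H *m q) = 0 -> c * `|q| ^+ 2 <= dot q (H *m q).
Hypothesis loc : localized f xbar H l s U U' v.

Let v1 : `|v| <= 1. Proof. by rewrite -ev1 norm_le_enorm. Qed.
Let f_diff x : U' x -> differentiable f x.
Proof. by move=> /f_diff2[/nbhs_singleton]. Qed.

Let vHvN : dot (- v) (H *m - v) = - a.
Proof. by rewrite mulmxN dotNl dotNr opprK. Qed.
Let v1N : `|- v| <= 1. Proof. by rewrite normrN. Qed.
Let coerciveN q : dot (- v) (H *m q) = 0 -> c * `|q| ^+ 2 <= dot q (H *m q).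
Proof. by rewrite dotNl => /eqP; rewrite oppr_eq0 => /eqP; exact: coercive. Qed.
Let locN := localizedN loc.

Local Notation S := (slice f U' l v).
Local Notation T2 y := (sup (S y)).
Local Notation T1 y := (inf (S y)).

(** Reversing v exchanges the two endpoints. *)
Lemma inf_sliceE x : T1 x = - sup (slice f U' l (- v) x).
Proof. by rewrite slice_opp. Qed.

Lemma slice_ends x : U x ->
  [/\ S x (T1 x), S x (T2 x), f (x + T1 x *: v) = l, f (x + T2 x *: v) = l &
      forall t, S x t -> T1 x <= t <= T2 x].
Proof.
move=> Ux.
have [S2 f2] := sup_slice_value f_aq U'xbar f_diff crit c0 ec lf coercive loc Ux.
have [S1 f1] := sup_slice_value f_aq U'xbar f_diff crit c0 ec lf coerciveN locN Ux.
have h2 := slice_has_sup f_aq U'xbar crit c0 ec lf coercive loc Ux.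
have h1 := slice_has_sup f_aq U'xbar crit c0 ec lf coerciveN locN Ux.
split => //.
- by move: S1; rewrite {1}slice_opp => -[t St tE]; rewrite inf_sliceE -tE opprK.
- by rewrite inf_sliceE scaleNr -scalerN.
- move=> t St; apply/andP; split; last exact: sup_upper_bound.
  rewrite inf_sliceE lerNl; apply: sup_upper_bound => //.
  by rewrite slice_opp; exists t.
Qed.

Lemma parallel_distanceE x : U x -> parallel_distance U' f l v x = T2 x - T1 x.
Proof.
move=> Ux; have [S1 S2 _ _ h] := slice_ends Ux.
by rewrite /parallel_distance line_superlevelE; exact: diam_segment.
Qed.

Lemma line_superlevel_bounded x : U x -> bounded_set (line_superlevel U' f l v x).
Proof.
move=> Ux; rewrite line_superlevelE; exists (`|x| + s); split; first exact: num_real.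
move=> M /ltW sM _ [t St <-]; apply: le_trans sM.
apply: le_trans (ler_normD _ _) _; rewrite lerD2l normrZ -[leRHS]mulr1.
by apply: ler_pM => //; apply/ltW; exact: slice_bound loc _ _ Ux St.
Qed.

Lemma inf_sup_continuous x : U x -> T1 x < T2 x ->
  {for x, continuous (fun y => T1 y)} /\ {for x, continuous (fun y => T2 y)}.
Proof.
move=> Ux T12; have [S1 S2 _ _ _] := slice_ends Ux; split; last first.
  exact: (sup_slice_continuous f_aq U'xbar f_diff crit a0 c0 e0 ea ec lf openU vHv v1 coercive loc Ux S1).
have -> : (fun y => T1 y) = - (fun y => sup (slice f U' l (- v) y)).
  by apply/funext => y; rewrite inf_sliceE.
apply: continuousN.
apply: (sup_slice_continuous f_aq U'xbar f_diff crit a0 c0 e0 ea ec lf openU vHvN v1N coerciveN locN Ux (t1 := - T2 x)).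
  by rewrite slice_opp; exists (T2 x).
by rewrite ltrNl -inf_sliceE.
Qed.

Lemma chord_near x : U x -> T1 x < T2 x -> \forall y \near x, U y /\ T1 y < T2 y.
Proof.
move=> Ux T12; have [c1 c2] := inf_sup_continuous Ux T12.
have cB : {for x, continuous (fun y => T2 y - T1 y)} by exact: continuousB.
have B0 : 0 < T2 x - T1 x by rewrite subr_gt0.
have near1 := continuous_near_gt cB B0.
have near2 : \forall y \near x, U y by exact: open_nbhs_nbhs.
near=> y; split; first by near: y.
by rewrite -subr_gt0; near: y.
Unshelve. all: by end_near. Qed.

Section Chord.
Variable x : V.
Hypotheses (Ux : U x) (T12 : T1 x < T2 x).
Let g := T2 x - T1 x.
Let p1 := x + T1 x *: v.
Let p2 := x + T2 x *: v.
Let tau1 := endpoint_gradient f v p1.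
Let tau2 := endpoint_gradient f v p2.
Let D1 := dot (gradient f p1) v.
Let D2 := dot (gradient f p2) v.

Let g0 : 0 < g. Proof. by rewrite subr_gt0. Qed.
Let p2E : p2 = p1 + g *: v.
Proof. by rewrite /p2 /p1 /g -addrA -scalerDl subrKC. Qed.
Let Up1 : U' p1. Proof. by have [[]] := slice_ends Ux. Qed.
Let Up2 : U' p2. Proof. by have [_ []] := slice_ends Ux. Qed.
Let fp1 : f p1 = l. Proof. by have [] := slice_ends Ux. Qed.
Let fp2 : f p2 = l. Proof. by have [] := slice_ends Ux. Qed.

Lemma chord_slopes_neq0 : D1 != 0 /\ D2 != 0.
Proof.
have Up2' := Up2; have fp2' := fp2; rewrite p2E in Up2' fp2'.
have h1 := chord_slope1 f_aq e0 vHv v1 g0 Up1 Up2' fp1 fp2'.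
have h2 := chord_slope2 f_aq e0 vHv v1 g0 Up1 Up2' fp1 fp2'.
rewrite -p2E -/D1 -/D2 in h1 h2.
have eg : e * g <= a / 8 * g by rewrite ler_pM2r.
have ag : 0 < a * g by exact: mulr_gt0.
have lin (X Y G : R) : 0 < G -> Y <= G / 8 -> `|X - G / 2| <= Y -> X != 0.
  move=> G0 YG; rewrite ler_norml => /andP[? _]; apply: lt0r_neq0; lra.
split.
  by apply: (lin _ (e * g) (a * g)) => //; rewrite mulrAC.
rewrite -oppr_eq0; apply: (lin _ (e * g) (a * g)) => //; first by rewrite mulrAC.
by rewrite -opprD normrN mulrAC.
Qed.

Lemma chord_differentiable :
  [/\ differentiable (fun y => T1 y) x, gradient (fun y => T1 y) x = tau1,
      differentiable (fun y => T2 y) x & gradient (fun y => T2 y) x = tau2].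
Proof.
have [c1 c2] := inf_sup_continuous Ux T12.
have [d1 d2] := chord_slopes_neq0.
have near2 : \forall y \near x, U y by exact: open_nbhs_nbhs.
have n1 : \forall y \near x, f (y + T1 y *: v) = f (x + T1 x *: v).
  by near=> y; rewrite -/p1 fp1; have [] := @slice_ends y; [near: y|].
have n2 : \forall y \near x, f (y + T2 y *: v) = f (x + T2 x *: v).
  by near=> y; rewrite -/p2 fp2; have [] := @slice_ends y; [near: y|].
have [] := endpoint_differentiable c1 (f_diff Up1) d1 n1.
by have [] := endpoint_differentiable c2 (f_diff Up2) d2 n2.
Unshelve. all: by end_near. Qed.

End Chord.

(** Where it is positive, the squared parallel distance is twice differentiable,
    with Hessian close to that of the model uniformly in x and l, and vanishing in
    the direction v. *)
Lemma distance_hessian x : U x -> 0 < parallel_distance U' f l v x ->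
  let h := hessian (fun y => parallel_distance U' f l v y ^+ 2) x in
  [/\ twice_differentiable (fun y => parallel_distance U' f l v y ^+ 2) x,
      `|h - model_hessian a H v| <=
        (32 * n%:R ^+ 2 * chord_bound H a c ^+ 4 + 2 * chord_bound H a c ^+ 2) * e &
      forall u b, dot (u + b *: v) (h *m (u + b *: v)) = dot u (h *m u)].
Proof.
move=> Ux; rewrite parallel_distanceE// subr_gt0 => T12 /=.
have nC := chord_near Ux T12.
have [S1 S2 fp1 fp2 Sb] := slice_ends Ux.
set p1 := x + T1 x *: v in S1 fp1; set p2 := x + T2 x *: v in S2 fp2.
have Up1 : U' p1 by case: S1.
have Up2 : U' p2 by case: S2.
have [D10 D20] := chord_slopes_neq0 Ux T12.
have [dT1 gT1 dT2 gT2] := chord_differentiable Ux T12.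
rewrite -/p1 -/p2 in D10 D20 gT1 gT2.
have n1 : \forall y \near x, differentiable (fun y => T1 y) y /\
     gradient (fun y => T1 y) y = endpoint_gradient f v (y + T1 y *: v).
  by move: nC; apply: filterS => y [Uy T12y]; have [] := chord_differentiable Uy T12y.
have n2 : \forall y \near x, differentiable (fun y => T2 y) y /\
     gradient (fun y => T2 y) y = endpoint_gradient f v (y + T2 y *: v).
  by move: nC; apply: filterS => y [Uy T12y]; have [] := chord_differentiable Uy T12y.
have [_ dg1] := f_diff2 Up1; have [_ dg2] := f_diff2 Up2.
have [t1 h1] := endpoint_twice_differentiable dg1 D10 n1.
have [t2 h2] := endpoint_twice_differentiable dg2 D20 n2.
have [t12 g12 h12] := twice_differentiableB t2 t1.
have [tsq hsq] := twice_differentiable_sqr t12.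
rewrite g12 h12 h1 h2 gT1 gT2 -/p1 -/p2 in hsq.
have nE : \forall y \near x, (T2 y - T1 y) ^+ 2 = parallel_distance U' f l v y ^+ 2.
  by move: nC; apply: filterS => y [Uy _]; rewrite parallel_distanceE.
have [tg hg] := twice_differentiable_near_eq nE tsq.
rewrite hg hsq; split; first exact: tg.
- have g0 : 0 < T2 x - T1 x by rewrite subr_gt0.
  have p2E : p2 = p1 + (T2 x - T1 x) *: v by rewrite /p2 /p1 -addrA -scalerDl subrKC.
  (* The foot lies on the chord, at the parameter t - T1 x counted from p1. *)
  have [t [St ts tv _]] := slice_foot f_aq U'xbar crit c0 ec lf coercive loc Ux.
  have /andP[tT1 tT2] := Sb _ St.
  have mE : x + t *: v = p1 + (t - T1 x) *: v by rewrite /p1 -addrA -scalerDl subrKC.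
  have tb : 0 <= t - T1 x <= T2 x - T1 x by rewrite subr_ge0 tT1 lerD2r.
  have Up2' := Up2; have fp2' := fp2; rewrite p2E in Up2' fp2'.
  have Um : U' (x + t *: v) by case: St.
  have := chord_estimates f_aq U'xbar crit a0 c0 e0 vHv v1 coercive ea ec g0 Up1 Up2' Um fp1 fp2' lf mE tb tv.
  rewrite -p2E => -[[q1 q2] [q3 q4] [q5 q6] q7].
  have [M1 M2] := chord_bound_ge H a0 c0.
  have U'p p : U' p -> `|hessian f p - H| <= e.
    by move=> Up; have [|_ _ //] := f_aq (x := p) (d := 0) Up; rewrite addr0.
  have e01 : 0 <= e <= 1 by rewrite e0 e1.
  exact: (square_hessian_close Hs a0 vHv v1 M1 M2 e01 q1 q2 q3 q4 q5 q6 q7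
    (U'p _ Up1) (U'p _ Up2)).
exact: chord_hessian_dir (endpoint_gradient_dir D10) (endpoint_gradient_dir D20).
Qed.

End DistanceHessian.

(** * Convexity of the squared parallel distance *)

(** Lowering the level by eta moves the upper endpoint by at most a multiple of
    the square root of eta, by strong concavity along v. *)
Lemma sup_slice_level (R : realType) (n : nat) (f : 'cV[R]_n -> R) (xbar : 'cV[R]_n)
    (H : 'M[R]_n) (a c e s l l' kappa : R) (U U' : set 'cV[R]_n) (v x : 'cV[R]_n) :
  almost_quadratic f H e U' -> U' xbar -> (forall x, U' x -> differentiable f x) ->
  gradient f xbar = 0 -> 0 < a -> 0 < c -> 0 <= e -> e <= a / 8 -> e <= c / 4 ->
  dot v (H *m v) = - a -> `|v| <= 1 ->
  (forall q, dot v (H *m q) = 0 -> c * `|q| ^+ 2 <= dot q (H *m q)) ->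
  localized f xbar H l s U U' v -> localized f xbar H l' s U U' v ->
  l <= f xbar -> l' <= l -> 0 < kappa -> 16 * (l - l') <= a * kappa ^+ 2 -> U x ->
  sup (slice f U' l v x) <= sup (slice f U' l' v x) <=
    sup (slice f U' l v x) + kappa.
Proof.
move=> faq U'x fd crit a0 c0 e0 ea ec vHv v1 co loc loc' lf ll' k0 kl Ux.
have lf' := le_trans ll' lf.
have [S2 f2] := sup_slice_value faq U'x fd crit c0 ec lf co loc Ux.
have [S2' f2'] := sup_slice_value faq U'x fd crit c0 ec lf' co loc' Ux.
have hs := slice_has_sup faq U'x crit c0 ec lf co loc Ux.
have hs' := slice_has_sup faq U'x crit c0 ec lf' co loc' Ux.
have b' := slice_bound loc' Ux S2'. have b := slice_bound loc Ux S2.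
have le1 : sup (slice f U' l v x) <= sup (slice f U' l' v x).
  by apply: sup_upper_bound => //; case: S2 => u1 u2; split => //; exact: le_trans u2.
rewrite le1 /=.
move: f2 f2' b b' le1 S2 S2' hs; set T := sup (slice f U' l v x); set T' := sup _.
move=> f2 f2' b b' le1 S2 S2' hs.
rewrite leNgt; apply/negP => ltT.
(* At the midpoint t of the two endpoints f is below l, so f decreases there; the
   concavity bound from t to T' then bounds (T' - T)^2. *)
pose t := (T + T') / 2.
have ts : `|t| <= s.
  move: b b'; rewrite !ltr_norml ler_norml /t => /andP[??] /andP[??].
  by apply/andP; split; lra.
have ft : f (x + t *: v) < l.
  rewrite ltNge; apply/negP => lt.
  have : slice f U' l v x t by split => //; case: loc => _ h _; exact: h.
  by move/(sup_upper_bound hs); rewrite -/T /t; lra.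
have c1 := slice_concave faq a0 e0 ea vHv v1 loc Ux ts (ltW b).
have c2 := slice_concave faq a0 e0 ea vHv v1 loc Ux ts (ltW b').
rewrite f2 in c1; rewrite f2' in c2.
move: c1 c2 ft; set D := dot _ _; set F := f _; rewrite /t.
have -> : T - (T + T') / 2 = - ((T' - T) / 2) by field.
have -> : T' - (T + T') / 2 = (T' - T) / 2 by field.
rewrite sqrrN mulNr; set w := (T' - T) / 2 => c1 c2 ft.
have w0 : 0 < w by rewrite /w; lra.
have wk : kappa / 2 < w by rewrite /w; lra.
have aw : 0 <= a / 4 * w ^+ 2 by rewrite mulr_ge0 ?sqr_ge0// divr_ge0// ltW.
have wD : w * D < 0.
  have lin (X Y G L : R) : L <= G - X - Y -> G < L -> 0 <= Y -> X < 0.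
    by move=> *; lra.
  exact: lin c1 ft aw.
have h : a / 4 * (kappa / 2) ^+ 2 < a / 4 * w ^+ 2.
  rewrite ltr_pM2l ?divr_gt0// ltr_pXn2r// nnegrE; last exact: ltW.
  by rewrite divr_ge0// ltW.
have E : a / 4 * (kappa / 2) ^+ 2 = a * kappa ^+ 2 / 16 by field.
rewrite E in h.
have lin (X Y Z G L L' : R) : L' <= G + X - Y -> G < L -> X < 0 ->
  Z / 16 < Y -> 16 * (L - L') <= Z -> L < L by move=> *; lra.
by have := lin _ _ _ _ _ _ c2 ft wD h kl; rewrite ltxx.
Qed.

Section Convexity.
Variables (R : realType) (n : nat).
Notation V := 'cV[R]_n.

Lemma convex_segment (U : set V) x y (s : R) : convex_set U -> U x -> U y ->
  0 <= s <= 1 -> U (x + s *: (y - x)).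
Proof.
move=> cU Ux Uy /andP[s0 s1].
have := cU y x (Itv01 s0 s1) (mem_set Uy) (mem_set Ux).
rewrite inE; congr U; rewrite -[LHS]/(s *: y + (1 - s) *: x) scalerBr scalerBl scale1r.
by rewrite addrCA addrA.
Qed.

(** The tangent hyperplane inequality, from the positivity of the second derivative
    along the segment. *)
Lemma gradient_inequality (F : V -> R) z d :
  (forall s : R, 0 <= s <= 1 -> twice_differentiable F (z + s *: d) /\
     0 <= dot d (hessian F (z + s *: d) *m d)) ->
  F z + dot (gradient F z) d <= F (z + d).
Proof.
move=> h.
have dF s : 0 <= s <= 1 -> differentiable F (z + s *: d).
  by move=> /h[[/nbhs_singleton]].
have [s s01|c /andP[c0 c1]] := @mean_value R (fun s => F (z + s *: d))
    (fun s => dot (gradient F (z + s *: d)) d) 0 1 ltr01.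
  by apply: is_derive_line; exact: dF.
rewrite scale1r scale0r addr0 subr0 mulr1 => E.
have [s /andP[s0 sc]|c' /andP[c0' c1']] := @mean_value R
    (fun s => dot d (gradient F (z + s *: d)))
    (fun s => dot d (hessian F (z + s *: d) *m d)) 0 c c0.
  apply: is_derive_gradient_line; have [|[] //] := h s.
  by rewrite s0 (le_trans sc) // ltW.
rewrite scale0r addr0 subr0 ![dot d (gradient _ _)]dotC => E'.
have c'01 : 0 <= c' <= 1 by rewrite (ltW c0') (le_trans (ltW c1')) // ltW.
have [_ h'] := h _ c'01.
rewrite -lerBrDl E -subr_ge0 E'.
by rewrite mulr_ge0// ltW.
Qed.

Lemma psd_hessian_convex (U : set V) (F : V -> R) : convex_set U ->
  (forall x, U x -> twice_differentiable F x /\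
    forall u, 0 <= dot u (hessian F x *m u)) ->
  convex_function U F.
Proof.
move=> cU h t x y /set_mem Ux /set_mem Uy.
have Uz : U (conv t x y) by apply: set_mem; apply: cU; exact: mem_set.
set z : V := conv t x y in Uz *.
have t0 : 0 <= t%:num by [].
have t1 : 0 <= 1 - t%:num by rewrite subr_ge0.
have ineq w : U w -> F z + dot (gradient F z) (w - z) <= F w.
  move=> Uw; rewrite -{2}(subrKC z w); apply: gradient_inequality => s s01.
  by have [? h2] := h _ (convex_segment cU Uz Uw s01); split.
have zE : z = t%:num *: x + (1 - t%:num) *: y by [].
have hx := ineq _ Ux; have hy := ineq _ Uy.
have sum0 : t%:num * dot (gradient F z) (x - z) + (1 - t%:num) * dot (gradient F z) (y - z) = 0.
  rewrite -!dotZr -dotDr [X in dot _ X](_ : _ = 0) ?dot0r//.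
  rewrite !scalerBr addrACA -zE -opprD -scalerDl subrKC scale1r subrr //.
have cE : conv t (F x : R^o) (F y : R^o) = t%:num * F x + (1 - t%:num) * F y by [].
rewrite cE.
have hx' := ler_wpM2l t0 hx; have hy' := ler_wpM2l t1 hy.
apply: le_trans (lerD hx' hy').
by rewrite !mulrDr addrACA sum0 addr0 -mulrDl subrKC mul1r.
Qed.

Variables (f : V -> R) (xbar : V) (H : 'M[R]_n) (a c e s gam : R) (U U' : set V).
Hypotheses (f_aq : almost_quadratic f H e U') (U'xbar : U' xbar).
Hypothesis f_diff2 : forall x, U' x -> twice_differentiable f x.
Hypothesis crit : gradient f xbar = 0.
Hypotheses (a0 : 0 < a) (c0 : 0 < c) (e0 : 0 <= e) (e1 : e <= 1).
Hypotheses (ea : e <= a / 8) (ec : e <= c / 4).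
Hypotheses (openU : open U) (convU : convex_set U).
Variable v : V.
Hypotheses (Hs : H^T = H) (vHv : dot v (H *m v) = - a) (ev1 : enorm v = 1).
Hypothesis coercive : forall q, dot v (H *m q) = 0 -> c * `|q| ^+ 2 <= dot q (H *m q).
Hypothesis loc : forall l, f xbar - gam < l <= f xbar -> localized f xbar H l s U U' v.
Hypothesis small : n%:R ^+ 2 *
  ((32 * n%:R ^+ 2 * chord_bound H a c ^+ 4 + 2 * chord_bound H a c ^+ 2) * e) <= 8 / a * c.

Local Notation S l := (slice f U' l v).
Local Notation dist l := (parallel_distance U' f l v).

Let v1 : `|v| <= 1. Proof. by rewrite -ev1 norm_le_enorm. Qed.
Let f_diff x : U' x -> differentiable f x.
Proof. by move=> /f_diff2[/nbhs_singleton]. Qed.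

(** By invariance along v, positivity of the Hessian need only be checked on
    vectors H-orthogonal to v, where the model Hessian is coercive. *)
Lemma distance_hessian_psd l x : f xbar - gam < l <= f xbar -> U x -> 0 < dist l x ->
  forall u, 0 <= dot u (hessian (fun y => dist l y ^+ 2) x *m u).
Proof.
move=> lr Ux dx u; have /andP[_ lf] := lr.
have [_ h1 h2] := distance_hessian f_aq U'xbar f_diff2 crit a0 c0 e0 e1 ea ec lf
  openU Hs vHv ev1 coercive (loc lr) Ux dx.
set h := hessian _ _ in h1 h2 *.
(* u + b v is H-orthogonal to v. *)
pose b := dot v (H *m u) / a.
have a0n := lt0r_neq0 a0.
have vu : dot v (H *m (u + b *: v)) = 0.
  by rewrite mulmxDr -scalemxAr dotDr dotZr vHv /b; field.
rewrite -(h2 u b); set w := u + b *: v in vu *.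
have -> : dot w (h *m w) = dot w (model_hessian a H v *m w)
    + dot w ((h - model_hessian a H v) *m w).
  by rewrite -dotDr -mulmxDl subrKC.
have -> : dot w (model_hessian a H v *m w) = 8 / a * dot w (H *m w).
  rewrite /model_hessian -scalemxAl mulmxDl -!mulmxA [v *m (v^T *m _)]mulmxA.
  by rewrite outer_mulmx vu scale0r mulmx0 add0r -scalemxAl !dotZr; field.
have h3 := norm_dot_mulmx (h - model_hessian a H v) w w.
have h4 : 8 / a * (c * `|w| ^+ 2) <= 8 / a * dot w (H *m w).
  by apply: ler_wpM2l; [rewrite divr_ge0// ltW|exact: coercive].
have h5 : n%:R ^+ 2 * `|h - model_hessian a H v| * `|w| * `|w| <= 8 / a * (c * `|w| ^+ 2).
  rewrite -[leLHS]mulrA -expr2 [leRHS]mulrA; apply: ler_wpM2r; first exact: sqr_ge0.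
  apply: le_trans small; apply: ler_wpM2l => //; exact: exprn_ge0.
move: h3; rewrite ler_norml => /andP[h3 _].
rewrite -(subrr (8 / a * (c * `|w| ^+ 2))); apply: lerD => //.
by apply: le_trans h3; rewrite lerN2.
Qed.

Lemma dist_gt0 l x : f xbar - gam < l < f xbar -> U x -> 0 < dist l x.
Proof.
move=> /andP[lg lf] Ux.
have lr : f xbar - gam < l <= f xbar by rewrite lg ltW.
have [t [St _ _ ft]] := slice_foot f_aq U'xbar crit c0 ec (ltW lf) coercive (loc lr) Ux.
have [S1 S2 f1 f2 /(_ _ St)] := slice_ends f_aq U'xbar f_diff2 crit c0 ec (ltW lf) coercive (loc lr) Ux.
rewrite (parallel_distanceE f_aq U'xbar f_diff2 crit c0 ec (ltW lf) ev1 coercive (loc lr) Ux).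
move=> /andP[]; rewrite !le_eqVlt subr_gt0 => /predU1P[E|t1].
  by have := ft lf; rewrite -E f1 ltxx.
move=> /predU1P[E|t2]; first by have := ft lf; rewrite E f2 ltxx.
exact: lt_trans t2.
Qed.

Lemma dist_convex_below l : f xbar - gam < l < f xbar ->
  convex_function U (fun x => dist l x ^+ 2).
Proof.
move=> lr; have /andP[lg lf] := lr.
have lr' : f xbar - gam < l <= f xbar by rewrite lg ltW.
apply: psd_hessian_convex => // x Ux.
have d0 := dist_gt0 lr Ux.
have [h _ _] := distance_hessian f_aq U'xbar f_diff2 crit a0 c0 e0 e1 ea ec (ltW lf)
  openU Hs vHv ev1 coercive (loc lr') Ux d0.
by split => //; exact: distance_hessian_psd.
Qed.

Lemma dist_level l l' kappa x : f xbar - gam < l <= f xbar ->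
  f xbar - gam < l' <= l -> 0 < kappa -> 16 * (l - l') <= a * kappa ^+ 2 -> U x ->
  dist l x <= dist l' x <= dist l x + 2 * kappa.
Proof.
move=> lr l'r k0 kl Ux.
have /andP[lg lf] := lr; have /andP[l'g ll'] := l'r.
have lf' := le_trans ll' lf.
have lr' : f xbar - gam < l' <= f xbar by rewrite l'g.
have vHvN : dot (- v) (H *m - v) = - a by rewrite mulmxN dotNl dotNr opprK.
have v1N : `|- v| <= 1 by rewrite normrN.
have coerciveN q : dot (- v) (H *m q) = 0 -> c * `|q| ^+ 2 <= dot q (H *m q).
  by rewrite dotNl => /eqP; rewrite oppr_eq0 => /eqP; exact: coercive.
have := sup_slice_level f_aq U'xbar f_diff crit a0 c0 e0 ea ec vHv v1 coercive
  (loc lr) (loc lr') lf ll' k0 kl Ux.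
have := sup_slice_level f_aq U'xbar f_diff crit a0 c0 e0 ea ec vHvN v1N coerciveN
  (localizedN (loc lr)) (localizedN (loc lr')) lf ll' k0 kl Ux.
rewrite (parallel_distanceE f_aq U'xbar f_diff2 crit c0 ec lf ev1 coercive (loc lr) Ux).
rewrite (parallel_distanceE f_aq U'xbar f_diff2 crit c0 ec lf' ev1 coercive (loc lr') Ux).
rewrite !inf_sliceE !opprK.
move: (sup _) (sup _) (sup _) (sup _) => p q p' q' /andP[h1 h2] /andP[h3 h4].
by apply/andP; split; lra.
Qed.

Lemma dist_ge0 l x : f xbar - gam < l <= f xbar -> U x -> 0 <= dist l x.
Proof.
move=> lr Ux; have /andP[lg lf] := lr.
have [S1 _ _ _ /(_ _ S1) /andP[_ h]] :=
  slice_ends f_aq U'xbar f_diff2 crit c0 ec lf coercive (loc lr) Ux.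
by rewrite (parallel_distanceE f_aq U'xbar f_diff2 crit c0 ec lf ev1 coercive (loc lr) Ux) subr_ge0.
Qed.

(** At the critical level the distance may vanish; convexity passes to the limit
    from the levels below. *)
Lemma dist_convex l : f xbar - gam < l <= f xbar ->
  convex_function U (fun x => dist l x ^+ 2).
Proof.
move=> lr t x y xU yU; have /andP[lg lf] := lr.
have Ux := set_mem xU; have Uy := set_mem yU.
have zU := convU t xU yU; have Uz := set_mem zU.
set z : V := conv t x y in zU Uz *.
have t0 : 0 <= t%:num by [].
have t1 : 0 <= 1 - t%:num by rewrite subr_ge0.
have cE (u w : R) : conv t (u : R^o) (w : R^o) = t%:num * u + (1 - t%:num) * w by [].
rewrite cE; set tt := t%:num in t0 t1 cE *.
have gx0 := dist_ge0 lr Ux; have gy0 := dist_ge0 lr Uy; have gz0 := dist_ge0 lr Uz.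
pose G := 4 * (dist l x + dist l y) + 4.
have G0 : 0 < G by rewrite ltr_wpDl// mulr_ge0// addr_ge0.
apply/ler_addgt0Pr => eta eta0.
pose kappa := Num.min 1 (Num.min (eta / G) ((l - (f xbar - gam)) * 8 / a)).
have k0 : 0 < kappa.
  by rewrite !lt_min ltr01 !divr_gt0 ?mulr_gt0// subr_gt0.
have k1 : kappa <= 1 by rewrite /kappa ge_min lexx.
have kG : kappa * G <= eta by rewrite -ler_pdivlMr// /kappa !ge_min lexx orbT.
have kl : a * kappa <= (l - (f xbar - gam)) * 8.
  by rewrite mulrC -ler_pdivlMr// /kappa !ge_min lexx !orbT.
(* The level for which the endpoints move by at most kappa. *)
pose l' := l - a * kappa ^+ 2 / 16.
have kk : kappa ^+ 2 <= kappa by rewrite expr2 ler_piMl// ltW.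
have akk : 0 < a * kappa ^+ 2 by rewrite mulr_gt0// exprn_gt0.
have akk2 : a * kappa ^+ 2 <= a * kappa by rewrite ler_pM2l.
have l'g : f xbar - gam < l' by move: lg kl akk2; rewrite /l'; set X := _ ^+ 2; lra.
have l'l : l' < l by rewrite /l'; lra.
have l'r : f xbar - gam < l' <= l by rewrite l'g ltW.
have l'r' : f xbar - gam < l' < f xbar by rewrite l'g (lt_le_trans l'l).
have lev : 16 * (l - l') <= a * kappa ^+ 2 by rewrite /l'; lra.
have /andP[hx1 hx2] := dist_level lr l'r k0 lev Ux.
have /andP[hy1 hy2] := dist_level lr l'r k0 lev Uy.
have /andP[hz1 hz2] := dist_level lr l'r k0 lev Uz.
have := dist_convex_below l'r' t xU yU; rewrite cE -/z -/tt.
move: gx0 gy0 gz0 hx1 hx2 hy1 hy2 hz1 G0 kG; rewrite /G.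
move: (dist l x) (dist l y) (dist l z) (dist l' x) (dist l' y) (dist l' z).
move=> gx gy gz gx' gy' gz' gx0 gy0 gz0 hx1 hx2 hy1 hy2 hz1 G0 kG h.
have hz : gz ^+ 2 <= gz' ^+ 2 by rewrite lerXn2r ?nnegrE// (le_trans gz0).
have sqb (u u' : R) : 0 <= u -> u <= u' -> u' <= u + 2 * kappa -> u' ^+ 2 <= u ^+ 2 + (4 * u + 4) * kappa.
  move=> u0 uu' u'u; apply: (@le_trans _ _ ((u + 2 * kappa) ^+ 2)).
    have u'0 := le_trans u0 uu'.
    by rewrite lerXn2r ?nnegrE//; exact: le_trans u'u.
  have -> : (u + 2 * kappa) ^+ 2 = u ^+ 2 + 4 * u * kappa + 4 * kappa ^+ 2 by ring.
  rewrite -subr_ge0.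
  have -> : u ^+ 2 + (4 * u + 4) * kappa - (u ^+ 2 + 4 * u * kappa + 4 * kappa ^+ 2) =
    4 * (kappa - kappa ^+ 2) by ring.
  by rewrite mulr_ge0// subr_ge0.
have sx := sqb _ _ gx0 hx1 hx2; have sy := sqb _ _ gy0 hy1 hy2.
apply: le_trans hz _; apply: le_trans h _.
have bx : gx' ^+ 2 <= gx ^+ 2 + eta.
  apply: le_trans sx _; rewrite lerD2l; apply: le_trans kG; rewrite mulrC.
  by apply: ler_wpM2l; [exact: ltW|lra].
have by' : gy' ^+ 2 <= gy ^+ 2 + eta.
  apply: le_trans sy _; rewrite lerD2l; apply: le_trans kG; rewrite mulrC.
  by apply: ler_wpM2l; [exact: ltW|lra].
apply: le_trans (lerD (ler_wpM2l t0 bx) (ler_wpM2l t1 by')) _.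
rewrite le_eqVlt; apply/orP; left; apply/eqP; ring.
Qed.

End Convexity.

(** * The parallel distance of the quadratic model *)

Section QuadraticModel.
Variables (R : realType) (n : nat).
Notation V := 'cV[R]_n.
Variables (H : 'M[R]_n) (xbar v : V) (a c k l : R).
Hypotheses (Hs : H^T = H) (a0 : 0 < a) (c0 : 0 < c).
Hypotheses (vHv : dot v (H *m v) = - a) (ev1 : enorm v = 1) (lk : l <= k).
Hypothesis coercive : forall q, dot v (H *m q) = 0 -> c * `|q| ^+ 2 <= dot q (H *m q).

Local Notation fbar := (quadratic_model H xbar k).

(* a^2 (t2 - t1)^2 / 4 for the two roots t1, t2 of fbar (x + t v) = l, where
   y = x - xbar. *)
Let disc (y : V) := dot v (H *m y) ^+ 2 + a * dot y (H *m y) + 2 * a * (k - l).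

Lemma model_disc_ge0 y : 0 <= disc y.
Proof.
(* disc y is a times the value of the form at the foot m, plus a nonnegative
   term. *)
pose m := y + (dot v (H *m y) / a) *: v.
have a0n := lt0r_neq0 a0.
have vm : dot v (H *m m) = 0.
  by rewrite /m mulmxDr -scalemxAr dotDr dotZr vHv; field.
have : 0 <= dot m (H *m m).
  by apply: le_trans (coercive vm); rewrite mulr_ge0 ?sqr_ge0// ltW.
have -> : dot m (H *m m) = dot y (H *m y) + dot v (H *m y) ^+ 2 / a.
  rewrite /m mulmxDr -scalemxAr !(dotDl, dotDr, dotZl, dotZr) vHv.
  by rewrite [dot y (H *m v)]dot_sym//; field.
rewrite -(pmulr_rge0 _ a0) mulrDr mulrCA divff// mulr1 => h.
rewrite /disc; apply: addr_ge0; first by rewrite addrC.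
by rewrite !mulr_ge0 ?subr_ge0// ltW.
Qed.

Lemma model_slice x t :
  slice fbar setT l v x t <-> (a * t - dot v (H *m (x - xbar))) ^+ 2 <= disc (x - xbar).
Proof.
rewrite /slice /= /quadratic_model quadratic_formE addrAC.
move: (x - xbar) => y; rewrite /disc.
rewrite mulmxDr -scalemxAr !(dotDl, dotDr, dotZl, dotZr) vHv [dot y (H *m v)]dot_sym//.
set b := dot v _; set q := dot y _.
have E : b ^+ 2 + a * q + 2 * a * (k - l) - (a * t - b) ^+ 2 =
   2 * a * (2^-1 * (q + t * b + (t * (b + t * - a))) + k - l) by field.
have a2 : 0 < 2 * a by rewrite mulr_gt0.
split => [[_ h]|h].
  rewrite -subr_ge0 E pmulr_rge0// subr_ge0; apply: le_trans h _.
  by rewrite le_eqVlt; apply/orP; left; apply/eqP; ring.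
split => //; move: h; rewrite -subr_ge0 E pmulr_rge0// subr_ge0 => /le_trans; apply.
by rewrite le_eqVlt; apply/orP; left; apply/eqP; ring.
Qed.

Lemma model_distance_sqr x : parallel_distance setT fbar l v x ^+ 2 =
  4 / a ^+ 2 * disc (x - xbar).
Proof.
have a0n := lt0r_neq0 a0.
set y := x - xbar; pose r := Num.sqrt (disc y).
have r0 : 0 <= r by exact: sqrtr_ge0.
have rr : r ^+ 2 = disc y by rewrite sqr_sqrtr// model_disc_ge0.
set b := dot v (H *m y).
have Sx t : slice fbar setT l v x t <-> (b - r) / a <= t <= (b + r) / a.
  rewrite model_slice -/y -/b -rr.
  have -> : ((a * t - b) ^+ 2 <= r ^+ 2) = (`|a * t - b| <= r).
    by rewrite -[RHS](@ler_pXn2r _ 2) ?nnegrE// real_normK ?num_real.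
  rewrite ler_norml ler_pdivlMr// ler_pdivrMr// [t * a]mulrC.
  by split => /andP[h1 h2]; apply/andP; split; lra.
rewrite /parallel_distance line_superlevelE (@diam_segment _ _ _ _ _ ((b - r) / a) ((b + r) / a))//.
- by rewrite -rr; field.
- by apply/Sx; rewrite lexx ler_pM2r ?invr_gt0//; lra.
- by apply/Sx; rewrite lexx andbT ler_pM2r ?invr_gt0//; lra.
- by move=> t /Sx.
Qed.

Lemma model_bounded x : bounded_set (line_superlevel setT fbar l v x).
Proof.
rewrite line_superlevelE; set b := dot v (H *m (x - xbar)).
pose B := (`|b| + (1 + disc (x - xbar))) / a.
exists (`|x| + B); split; first exact: num_real.
move=> M /ltW sM _ [t St <-]; apply: le_trans sM.
apply: le_trans (ler_normD _ _) _; rewrite lerD2l normrZ -[leRHS]mulr1.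
have d0 := model_disc_ge0 (x - xbar).
apply: ler_pM => //; last by rewrite -ev1 norm_le_enorm.
move/model_slice: St; rewrite -/b; move: (disc _) @B d0 => D B D0 h.
rewrite /B ler_pdivlMr// mulrC -(gtr0_norm a0) -normrM.
have -> : a * t = b + (a * t - b) by rewrite subrKC.
apply: le_trans (ler_normD _ _) _; rewrite lerD2l.
rewrite -(@ler_pXn2r _ 2) ?nnegrE ?addr_ge0// real_normK ?num_real//.
apply: le_trans h _; rewrite -subr_ge0.
have -> : (1 + D) ^+ 2 - D = 1 + D + D ^+ 2 by ring.
by rewrite !addr_ge0 ?sqr_ge0.
Qed.

Lemma model_distance_hessian x :
  let g2 := fun x => parallel_distance setT fbar l v x ^+ 2 in
  twice_differentiable g2 x /\ hessian g2 x = model_hessian a H v.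
Proof.
move=> g2; have a0n := lt0r_neq0 a0.
pose A := (4 / a ^+ 2) *: (H *m v *m v^T *m H + a *: H).
have g2E : g2 = fun x => dot (x - xbar) (A *m (x - xbar)) + 4 / a ^+ 2 * (2 * a * (k - l)).
  apply/funext => y; rewrite /g2 model_distance_sqr /A; move: (y - xbar) => w.
  rewrite -scalemxAl mulmxDl -!mulmxA [v *m (v^T *m _)]mulmxA outer_mulmx.
  rewrite -scalemxAr -scalemxAl dotZr dotDr !dotZr [dot w (H *m v)]dot_sym// /disc.
  by ring.
have [] := quadratic_hessian A xbar (4 / a ^+ 2 * (2 * a * (k - l))) x.
rewrite -g2E => tg ->; split => //.
have As : A^T = A.
  rewrite /A linearZ linearD /= linearZ /= Hs; congr (_ *: (_ + _)).
  by rewrite !trmx_mul trmxK Hs !mulmxA.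
by rewrite As /A /model_hessian -scalerDl; congr (_ *: _); field.
Qed.

End QuadraticModel.

(** * Choice of the neighborhoods *)

Section Neighborhoods.
Variables (R : realType) (V : normedModType R).

Lemma mem_ball (x : V) (r : R) y : ball x r y = (`|x - y| < r) :> Prop.
Proof. by rewrite -ball_normE. Qed.

Lemma continuous_ball (W : normedModType R) (F : V -> W) x : {for x, continuous F} ->
  forall e : R, 0 < e ->
  exists2 r : R, 0 < r & forall y, ball x r y -> `|F x - F y| <= e.
Proof.
move=> /cvgrPdist_le cF e e0; have /nbhs_ballP[r r0 h] := cF e e0.
by exists r.
Qed.

Lemma near_ball (P : V -> Prop) x : (\forall y \near x, P y) ->
  exists2 r : R, 0 < r & forall y, ball x r y -> P y.
Proof. by move=> /nbhs_ballP[r r0 h]; exists r. Qed.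

End Neighborhoods.

Section Localization.
Variables (R : realType) (n : nat).
Notation V := 'cV[R]_n.

Lemma ball_segment (x y z : V) (r s : R) : ball x r y -> ball x r (y + z) ->
  0 <= s <= 1 -> ball x r (y + s *: z).
Proof.
rewrite !mem_ball => xy xz /andP[s0 s1].
have -> : x - (y + s *: z) = (1 - s) *: (x - y) + s *: (x - (y + z)).
  by apply/colP => i; rewrite !mxE; ring.
apply: le_lt_trans (ler_normD _ _) _; rewrite !normrZ ger0_norm ?subr_ge0// ger0_norm//.
move: xy xz; set p := `|_|; set q := `|_| => xp xq.
have [s1'|s1'] := ltP s 1.
  have -> : r = (1 - s) * r + s * r by ring.
  by apply: ltr_leD; [rewrite ltr_pM2l ?subr_gt0|rewrite ler_wpM2l// ltW].
have -> : s = 1 by apply/eqP; rewrite eq_le s1 s1'.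
by rewrite subrr mul0r add0r mul1r.
Qed.

Lemma ball_convex_open_nbhs (x : V) (r : R) : 0 < r -> convex_open_nbhs x (ball x r).
Proof.
move=> r0; split; first by split; [exact: ball_open|exact: ballxx].
move=> y z t /set_mem xy /set_mem xz; apply: mem_set.
have -> : conv t y z = z + t%:num *: (y - z).
  rewrite -[LHS]/(t%:num *: (y : V) + (1 - t%:num) *: (z : V)) scalerBr scalerBl scale1r.
  by rewrite addrCA addrA.
apply: ball_segment => //; first by rewrite subrKC.
by apply/andP; split.
Qed.

Variables (H : 'M[R]_n) (xbar v : V) (a K s e : R).
Hypotheses (a0 : 0 < a) (s0 : 0 < s) (vHv : dot v (H *m v) = - a) (v1 : `|v| <= 1).
Hypotheses (Hs : H^T = H) (aK : a <= K) (HK : n%:R ^+ 2 * `|H| <= K) (ea : e <= a / 16).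

(** Near xbar, the points of a line parallel to v where a quadratic form close to
    that of H is not too negative are close to xbar: along v the form decreases
    at the rate a. *)
Lemma quadratic_localization (y : V) (t : R) : `|y| < a / (16 * K) * s ->
  - (a * s ^+ 2 / 8) < 2^-1 * dot (y + t *: v) (H *m (y + t *: v)) + e * `|y + t *: v| ^+ 2 ->
  `|t| < s.
Proof.
move=> yr h; rewrite ltNge; apply/negP => st.
have K0 : 0 < K by exact: lt_le_trans aK.
have K0n := lt0r_neq0 K0.
set k := a / (16 * K) in yr.
have k0 : 0 < k by rewrite divr_gt0// mulr_gt0.
have Kk : K * k = a / 16 by rewrite /k; field.
have k16 : k <= 1 / 16.
  by rewrite -(@ler_pM2l _ K)// Kk mulrA mulr1 ler_pM2r ?invr_gt0.
have [tau tauE] : exists tau : R, tau = `|t| by eexists.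
rewrite -tauE in st.
have tau0 : 0 < tau by exact: lt_le_trans st.
have yt : `|y| <= k * tau by apply: le_trans (ltW yr) _; apply: ler_wpM2l => //; exact: ltW.
have tt : t ^+ 2 = tau ^+ 2 by rewrite tauE real_normK ?num_real.
have hb u w : `|dot u (H *m w)| <= K * `|u| * `|w|.
  by apply: le_trans (norm_dot_mulmx _ _ _) _; rewrite !ler_wpM2r.
have qy : dot y (H *m y) <= a / 16 * (tau ^+ 2 / 16).
  apply: le_trans (ler_norm _) _; apply: le_trans (hb _ _) _.
  apply: (@le_trans _ _ (K * (k * tau) * (k * tau))).
    apply: ler_pM => //; first by rewrite mulr_ge0// ltW.
    by apply: ler_wpM2l => //; exact: ltW.
  have -> : K * (k * tau) * (k * tau) = a / 16 * (k * tau ^+ 2) by rewrite -Kk; ring.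
  apply: ler_wpM2l; first by rewrite divr_ge0// ltW.
  rewrite mulrC; apply: ler_wpM2l; first exact: sqr_ge0.
  by rewrite div1r in k16.
have qyv : t * dot v (H *m y) <= a / 16 * tau ^+ 2.
  apply: le_trans (ler_norm _) _; rewrite normrM -tauE.
  apply: (@le_trans _ _ (tau * (K * 1 * (k * tau)))).
    apply: ler_wpM2l; first exact: ltW.
    apply: le_trans (hb _ _) _; apply: ler_pM => //; first by rewrite mulr_ge0// ltW.
    by apply: ler_wpM2l => //; exact: ltW.
  by rewrite -Kk le_eqVlt; apply/orP; left; apply/eqP; ring.
have eyt : e * `|y + t *: v| ^+ 2 <= a / 16 * (2 * tau ^+ 2).
  apply: (@le_trans _ _ (a / 16 * `|y + t *: v| ^+ 2)); first by apply: ler_wpM2r => //; exact: sqr_ge0.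
  apply: ler_wpM2l; first by rewrite divr_ge0// ltW.
  apply: (@le_trans _ _ ((k * tau + tau) ^+ 2)).
    have nn : 0 <= k * tau + tau.
      by apply: addr_ge0; [apply: mulr_ge0|]; exact: ltW.
    rewrite lerXn2r ?nnegrE//.
    apply: le_trans (ler_normD _ _) _; apply: lerD => //.
    by rewrite normrZ -tauE -[leRHS]mulr1; apply: ler_pM => //; exact: ltW.
  have -> : (k * tau + tau) ^+ 2 = (k + 1) ^+ 2 * tau ^+ 2 by ring.
  apply: ler_wpM2r; first exact: sqr_ge0.
  move: k0 k16; nra.
have st2 : a * s ^+ 2 <= a * tau ^+ 2.
  by apply: ler_wpM2l; [exact: ltW|rewrite lerXn2r ?nnegrE// ltW].
have st0 : 0 < a * tau ^+ 2 by rewrite mulr_gt0// exprn_gt0.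
move: h; rewrite mulmxDr -scalemxAr !(dotDl, dotDr, dotZl, dotZr) vHv.
rewrite [dot y (H *m v)]dot_sym//.
rewrite [X in 2^-1 * X](_ : _ = dot y (H *m y) + t * dot v (H *m y)
    + (t * dot v (H *m y) - a * tau ^+ 2)); last by rewrite -tt; ring.
have E1 : a / 16 * (tau ^+ 2 / 16) = a * tau ^+ 2 / 256 by field.
have E2 : a / 16 * tau ^+ 2 = a * tau ^+ 2 / 16 by field.
have E3 : a / 16 * (2 * tau ^+ 2) = a * tau ^+ 2 / 8 by field.
rewrite E1 in qy; rewrite E2 in qyv; rewrite E3 in eyt.
have lin (S T Y X E : R) : - (S / 8) < 2^-1 * (Y + X + (X - T)) + E ->
  Y <= T / 256 -> X <= T / 16 -> E <= T / 8 -> S <= T -> 0 < T -> T < T by move=> *; lra.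
by move=> h; have := lin _ _ _ _ _ h qy qyv eyt st2 st0; rewrite ltxx.
Qed.

End Localization.

Theorem theorem4p9 (R : realType) (n : nat) (f : 'cV[R]_n -> R)
    (xbar vbar : 'cV[R]_n) (lambda : R)
    (f_C2 : C2_near f xbar)
    (xbar_index1 : nondegenerate_critical_index1 f xbar)
    (lambda_lt0 : lambda < 0)
    (vbar_eigen : hessian f xbar *m vbar = lambda *: vbar)
    (vbar_unit : enorm vbar = 1) :
  let H := hessian f xbar in
  exists2 alpha0 : R, 0 < alpha0 &
  forall v : 'cV[R]_n, enorm v = 1 -> enorm (v - vbar) < alpha0 ->
  forall eps : R, 0 < eps ->
  exists (delta gamma : R) (U U' : set 'cV[R]_n),
  [/\ 0 < delta, 0 < gamma,
      [/\ convex_open_nbhs xbar U, convex_open_nbhs xbar U' & U `<=` U'],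
      condP f xbar v delta gamma U U' &
  forall l : R, f xbar - gamma < l <= f xbar ->
  let fbar := quadratic_model H xbar (f xbar) in
  let g2 := fun x => parallel_distance U' f l v x ^+ 2 in
  let gbar2 := fun x => parallel_distance setT fbar l v x ^+ 2 in
  ((forall x, U x -> bounded_set (line_superlevel U' f l v x)) /\
   convex_function U g2) /\
  (forall x, U x -> 0 < parallel_distance U' f l v x ->
   [/\ twice_differentiable g2 x,
       bounded_set (line_superlevel setT fbar l v x),
       twice_differentiable gbar2 x,
       opnorm (hessian g2 x - hessian gbar2 x) <= eps &
       hessian gbar2 x =
         (8 / quadratic_form H v ^+ 2) *:
           (H *m v *m v^T *m H - quadratic_form H v *: H)])].
Proof.
move=> H; have [crit Hu Hone] := xbar_index1; rewrite -/H in Hu Hone.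
have [tf cH] : twice_differentiable f xbar /\ {for xbar, continuous (hessian f)}.
  exact: nbhs_singleton f_C2.
have Hs : H^T = H by exact: hessian_sym.
have vbar0 : vbar != 0.
  by apply/eqP => E; move: vbar_unit; rewrite E enormE dot0l sqrtr0 => /esym/eqP; rewrite oner_eq0.
have vbarH : dot vbar (H *m vbar) < 0.
  by rewrite vbar_eigen dotZr -enorm_sqr vbar_unit expr1n mulr1.
have [alpha0 al0 neg] := near_ball (continuous_near_lt (@quadratic_continuous R n H vbar) vbarH).
exists alpha0 => // v ev1 vvbar eps eps0.
have vHv0 : dot v (H *m v) < 0.
  apply: neg; rewrite mem_ball distrC; apply: le_lt_trans vvbar; exact: norm_le_enorm.
have v1 : `|v| <= 1 by rewrite -ev1 norm_le_enorm.
pose a := - dot v (H *m v).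
have a0 : 0 < a by rewrite oppr_gt0.
have vHv : dot v (H *m v) = - a by rewrite opprK.
have [c c0 coercive] := index1_coercive Hs Hu Hone lambda_lt0 vbar_eigen vbar0 vHv0.
(* e bounds the errors in the expansions of f on U'. It is small relative to KK,
   the constant of the comparison of the two Hessians, and serves as delta. *)
pose KK := 32 * n%:R ^+ 2 * chord_bound H a c ^+ 4 + 2 * chord_bound H a c ^+ 2.
have [cb1 _] := chord_bound_ge H a0 c0.
have cb0 : 0 <= chord_bound H a c by exact: le_trans cb1.
have KK0 : 0 <= KK by rewrite addr_ge0// !mulr_ge0// exprn_ge0.
have nKK0 : 0 <= n%:R ^+ 2 * KK by rewrite mulr_ge0// exprn_ge0.
pose K0 := 1 + n%:R ^+ 2 * KK + n%:R.
have K00 : 0 < K0 by rewrite ltr_wpDr// ltr_wpDr.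
pose e := Num.min 1 (Num.min (a / 16) (Num.min (c / 4) (Num.min (8 / a * c / K0)
  (Num.min (eps / K0) (a / 16 / K0))))).
have e0 : 0 < e by rewrite !lt_min ltr01 !divr_gt0// mulr_gt0// divr_gt0.
have e1 : e <= 1 by rewrite /e ge_min lexx.
have ea16 : e <= a / 16 by rewrite /e !ge_min lexx !orbT.
have ec : e <= c / 4 by rewrite /e !ge_min lexx !orbT.
have eK1 : e * K0 <= 8 / a * c by rewrite -ler_pdivlMr// /e !ge_min lexx !orbT.
have eK2 : e * K0 <= eps by rewrite -ler_pdivlMr// /e !ge_min lexx !orbT.
have eK3 : e * K0 <= a / 16 by rewrite -ler_pdivlMr// /e !ge_min lexx !orbT.
have ea : e <= a / 8 by move: ea16 a0; clear; lra.
have e0' : 0 <= e by exact: ltW.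
have KKe : n%:R ^+ 2 * (KK * e) <= e * K0.
  rewrite mulrA mulrC; apply: ler_wpM2l => //.
  by rewrite /K0 -addrA addrCA lerDl addr_ge0.
have ne : e * n%:R <= e * K0.
  by apply: ler_wpM2l => //; rewrite /K0 lerDr addr_ge0.
(* e' bounds the entries of the difference of Hessians; passing to the operator
   norm or to bilinear forms costs a factor n^2. *)
pose e' := e / (1 + n%:R ^+ 2).
have n20 : 0 < 1 + n%:R ^+ 2 :> R by rewrite ltr_wpDr// exprn_ge0.
have e'0 : 0 < e' by rewrite divr_gt0.
have e'e : n%:R ^+ 2 * e' <= e.
  by rewrite /e' mulrCA ler_piMr// ler_pdivrMr// mul1r lerDr.
have e'e1 : e' <= e by rewrite /e' ler_pdivrMr// ler_peMr// lerDl exprn_ge0.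
have e'n : n%:R * e' <= e.
  apply: le_trans e'e; apply: ler_wpM2r; first exact: ltW.
  by rewrite -natrX ler_nat; case: (n) => // m; rewrite expnS leq_pmulr// expn1.
have [r1 r10 h1] := near_ball f_C2.
have [r2 r20 h2] := continuous_ball cH e'0.
pose r := Num.min r1 r2.
have r0 : 0 < r by rewrite lt_min r10.
pose U' := ball xbar r.
have U'1 x : U' x -> twice_differentiable f x.
  move=> U'x; have [] // : twice_differentiable f x /\ {for x, continuous (hessian f)}.
  apply: h1; move: U'x; rewrite /U' !mem_ball => /lt_le_trans; apply.
  by rewrite /r ge_min lexx.
have U'2 x : U' x -> `|hessian f x - H| <= e'.
  move=> U'x; rewrite distrC; apply: h2; move: U'x; rewrite /U' !mem_ball => /lt_le_trans; apply.
  by rewrite /r ge_min lexx orbT.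
have U'xbar : U' xbar by exact: ballxx.
have f_aq : almost_quadratic f H e U'.
  move=> x d Ux Uxd.
  have seg (s : R) : 0 <= s <= 1 ->
      twice_differentiable f (x + s *: d) /\ `|hessian f (x + s *: d) - H| <= e'.
    by move=> s01; have Us := ball_segment Ux Uxd s01; split; [exact: U'1|exact: U'2].
  split.
  - apply: le_trans (taylor_second_order (ltW e'0) seg) _.
    by apply: ler_wpM2r => //; exact: sqr_ge0.
  - by apply: le_trans (taylor_gradient seg (ltW e'0)) _; apply: ler_wpM2r.
  - by apply: le_trans e'e1; exact: U'2.
pose s := r / 2.
have s0 : 0 < s by rewrite divr_gt0.
(* The radius rho of U is a small multiple of the half radius s of U', so that
   the chords of the lines through U do not leave U'. *)
pose K := a + n%:R ^+ 2 * `|H|.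
have nH0 : 0 <= n%:R ^+ 2 * `|H| by rewrite mulr_ge0// exprn_ge0.
have aK : a <= K by rewrite lerDl.
have HK : n%:R ^+ 2 * `|H| <= K by rewrite lerDr ltW.
have K0' : 0 < K by exact: lt_le_trans aK.
pose rho := a / (16 * K) * s.
have rho0 : 0 < rho by rewrite mulr_gt0// divr_gt0// mulr_gt0.
have rhos : rho <= s.
  rewrite /rho ler_piMl ?(ltW s0)// ler_pdivrMr ?mulr_gt0// mul1r.
  by apply: le_trans aK _; rewrite ler_peMl ?ler1n// ltW.
pose U := ball xbar rho.
pose gam := a * s ^+ 2 / 8.
have gam0 : 0 < gam by rewrite divr_gt0// mulr_gt0// exprn_gt0.
have slack (x : 'cV[R]_n) (t : R) : U x -> `|t| <= s -> U' (x + t *: v).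
  rewrite /U /U' !mem_ball opprD addrA => Ux ts.
  apply: le_lt_trans (ler_normB _ _) _.
  have tv : `|t *: v| <= s by rewrite normrZ -[leRHS]mulr1; apply: ler_pM.
  have -> : r = s + s by rewrite /s -splitr.
  by apply: ltr_leD => //; exact: lt_le_trans rhos.
have loc_gen (x : 'cV[R]_n) (t E : R) : U x -> E <= a / 16 ->
    - gam < 2^-1 * dot (x - xbar + t *: v) (H *m (x - xbar + t *: v))
      + E * `|x - xbar + t *: v| ^+ 2 -> `|t| < s.
  move=> Ux Ea h; apply: (quadratic_localization a0 s0 vHv v1 Hs aK HK Ea _ h).
  by rewrite distrC; move: Ux; rewrite /U mem_ball.
have loc l : f xbar - gam < l <= f xbar -> localized f xbar H l s U U' v.
  move=> /andP[lg lf]; split => //.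
  - move=> x t Ux U'x lx; apply: (loc_gen x t e Ux ea16).
    have := f_aq xbar (x - xbar + t *: v) U'xbar.
    have -> : xbar + (x - xbar + t *: v) = x + t *: v by rewrite addrA subrKC.
    move=> /(_ U'x) [+ _ _]; rewrite crit dot0l subr0 ler_norml => /andP[_].
    move: lg lx; set A := f (x + t *: v); set B := 2^-1 * _; set C := e * _.
    have lin (G L A' B' C' F : R) : F - G < L -> L <= A' -> A' - F - B' <= C' -> - G < B' + C'.
      by move=> *; lra.
    exact: lin.
  - move=> x Ux; exists (dot v (H *m (x - xbar)) / a); last first.
      rewrite addrAC mulmxDr -scalemxAr dotDr dotZr vHv mulrN divfK ?subrr//.
      exact: lt0r_neq0.
    rewrite normrM normfV (gtr0_norm a0) ler_pdivrMr// mulrC.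
    have xr : `|x - xbar| <= rho by rewrite distrC; move: Ux; rewrite /U mem_ball => /ltW.
    apply: le_trans (norm_dot_mulmx _ _ _) _.
    apply: (@le_trans _ _ (K * 1 * rho)).
      by do 2!apply: ler_pM => //; rewrite mulr_ge0.
    rewrite /rho mulr1 mulrA [K * _](_ : _ = a / 16); last by field; exact: lt0r_neq0.
    by apply: ler_wpM2r; [exact: ltW|rewrite ler_pdivrMr// ler_peMr ?ler1n// ltW].
have UU' : U `<=` U'.
  move=> x Ux; have := @slack x 0 Ux; rewrite scale0r addr0; apply.
  by rewrite normr0 ltW.
exists e, gam, U, U'; split; [exact: e0|exact: gam0| | |].
- by split => //; exact: ball_convex_open_nbhs.
- split.
    move=> x U'x; split; first exact: U'1.
    by apply: le_trans e'e; apply: opnorm_le; exact: U'2.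
  move=> x l Ux /andP[lg lf]; rewrite line_superlevelE => _ [t [_ lt] <-].
  apply: slack => //; apply/ltW; apply: (loc_gen x t (e * n%:R) Ux).
    exact: le_trans ne eK3.
  move: lt; rewrite /quadratic_model quadratic_formE addrAC.
  set w := x - xbar + t *: v.
  rewrite mulmxDl dotDr mul_scalar_mx dotZr => lt.
  have ww : dot w w <= n%:R * `|w| ^+ 2.
    by apply: le_trans (ler_norm _) _; rewrite expr2 mulrA; exact: norm_dot.
  have eww : e * dot w w <= e * n%:R * `|w| ^+ 2 by rewrite -mulrA; apply: ler_wpM2l.
  have eww0 : 0 <= e * dot w w by rewrite mulr_ge0// dot_ge0.
  move: lg lt eww eww0; rewrite -/H; set X := dot w (H *m w); set Y := e * dot w w; set Z := _ * `|w| ^+ 2.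
  have lin (G F L X' Y' Z' : R) : F - G < L -> L <= 2^-1 * (X' + Y') + F -> Y' <= Z' -> 0 <= Y' ->
    - G < 2^-1 * X' + Z' by move=> *; lra.
  exact: lin.
move=> l lr fbar g2 gbar2; have /andP[lg lf] := lr.
have [[openU _] convU] := ball_convex_open_nbhs xbar rho0.
have small : n%:R ^+ 2 * (KK * e) <= 8 / a * c by exact: le_trans KKe eK1.
split; first split.
- by move=> x Ux; exact: line_superlevel_bounded ev1 (loc _ lr) _ Ux.
- exact: (dist_convex f_aq U'xbar U'1 crit a0 c0 e0' e1 ea ec openU convU Hs vHv ev1 coercive loc small lr).
move=> x Ux dx.
have [t2 hclose _] := distance_hessian f_aq U'xbar U'1 crit a0 c0 e0' e1 ea ec lf
  openU Hs vHv ev1 coercive (loc _ lr) Ux dx.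
have [t2' hE] := model_distance_hessian xbar Hs a0 c0 vHv ev1 lf coercive x.
have qH : quadratic_form H v = - a by rewrite quadratic_formE.
split; [exact: t2| |exact: t2'| |].
- exact: (model_bounded xbar Hs a0 c0 vHv ev1 lf coercive).
- rewrite hE; apply: le_trans (opnorm_le hclose) _.
  exact: le_trans KKe eK2.
- by rewrite hE qH sqrrN scaleNr opprK.
Qed.
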